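(* Let $X$ be a shift of finite type (SFT) with positive entropy $\mathbf{h}(X)=\log\lambda$. Then for every $\alpha$ with $1/\lambda<\alpha\le1$ and every $\varepsilon>0$, $$\lim_{n\to\infty}\mathbb{P}_\alpha\big(|\mathbf{h}(X_\omega)-\log(\alpha\lambda)|\ge\varepsilon\big)=0,$$ and the convergence to this limit is exponential in $n$ (i.e. there are $K,\rho>0$, depending on $X,\alpha,\varepsilon$, such that the probability is at most $Ke^{-\rho n}$ for all sufficiently large $n$).
   Context: SFTs. Let $\mathcal{A}$ be a finite alphabet and $\sigma$ the left shift on $\mathcal{A}^{\mathbb{Z}}$ (product of discrete topologies). For a finite set $\mathcal{F}$ of finite words over $\mathcal{A}$, $X(\mathcal{F})$ is the set of $x\in\mathcal{A}^{\mathbb{Z}}$ in which no word of $\mathcal{F}$ appears; a shift of finite type (SFT) is a set $X$ of the form $X(\mathcal{F})$ with $\mathcal{F}$ finite. $B_n(X)$ is the set of words of length $n$ appearing in some $x\in X$. The entropy of $X$ is $\mathbf{h}(X)=\lim_n\frac1n\log|B_n(X)|$ (equal to $-\infty$ for the empty SFT). Random SFTs. $\Omega_n$ is the power set of $B_n(X)$. For $\alpha\in[0,1]$, $\mathbb{P}_\alpha$ is the probability measure on $\Omega_n$ obtained by including each word of $B_n(X)$ in the random subset $\omega$ independently with probability $\alpha$ (the dependence of $\mathbb{P}_\alpha$ on $n$ is suppressed). To $\omega\in\Omega_n$ one associates the SFT $X_\omega$ of all $x\in X$ such that every word of length $n$ appearing in $x$ belongs to $\omega$. *)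

(* Defs.v *)
From HB Require Import structures.
From mathcomp Require Import all_boot all_order all_algebra.
From mathcomp Require Import all_classical all_reals all_analysis.

Set Implicit Arguments.
Unset Strict Implicit.
Unset Printing Implicit Defensive.

Import Order.TTheory GRing.Theory Num.Theory.
Import numFieldNormedType.Exports.

Local Open Scope classical_set_scope.
Local Open Scope ring_scope.

Section SFT.
Context {A : finType}.

Definition word_at (x : int -> A) (i : int) (n : nat) : n.-tuple A :=
  [tuple x (i + (val j)%:Z) | j < n].

Definition appears (w : seq A) (x : int -> A) : Prop :=
  exists i : int, w = word_at x i (size w) :> seq A.

Definition avoiding (F : seq (seq A)) : set (int -> A) :=
  [set x | forall w, w \in F -> ~ appears w x].

Definition is_SFT (X : set (int -> A)) : Prop :=
  exists F : seq (seq A), X = avoiding F.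

Definition language (X : set (int -> A)) (n : nat) : {set n.-tuple A} :=
  finset (fun w : n.-tuple A => `[< exists2 x, X x & appears w x >]).

(* [lne] sends 0 to -oo, so the entropy of the empty subshift is -oo. *)
Definition entropy (R : realType) (X : set (int -> A)) : \bar R :=
  limn (fun n => ((n%:R^-1)%:E * lne (#|language X n|%:R)%:E)%E).

Definition sub_SFT (X : set (int -> A)) (n : nat) (omega : {set n.-tuple A}) :
    set (int -> A) :=
  [set x | X x /\ forall w : n.-tuple A, appears w x -> w \in omega].

(* Law of the random subset of [language X n] that contains each word
   independently with probability [alpha], evaluated at the event [E]. *)
Definition random_words_prob (R : realType) (X : set (int -> A)) (alpha : R)
    (n : nat) (E : set {set n.-tuple A}) : R :=
  \sum_(omega in powerset (language X n) | `[< E omega >])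
    \prod_(w in language X n) (if w \in omega then alpha else 1 - alpha).

End SFT.

Arguments entropy {A} R X.
Arguments random_words_prob {A R} X alpha n E.

(* Main.v *)
(** A word with [p] windows of length [n] survives in the random subshift with
    probability [alpha ^ (number of distinct windows)].  Repeated windows are
    paid for by the letters that they determine: cut the starting positions
    into cells of length [n]; in each cell the first and last repeated windows
    cover all the others, so a word is determined by a polynomial amount of
    data per cell together with its letters outside the repeated windows, and
    each position outside them starts a new window.  This gives
      [sum over words of alpha ^ (new windows) <= (poly(n) (alpha lambda)^n)^C]
    for words of length about [C n], up to subexponential factors.
    Upper tail: the first moment of the number of surviving words of length
    [(C + 1) n], with [C] large so that the boundary effect [#|A| ^ n] is
    negligible.  Lower tail: the second moment of the number of surviving
    periodic words of period [p] close to [C n]; pairs sharing a window can be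
    rotated so that a whole cell is determined, which gains [(alpha lambda)^n].
    Surviving periodic words with a common prefix of length [n] concatenate
    freely, hence bound the entropy from below.  That [X] has enough periodic
    words needs no irreducibility: among [#|A| ^ N + 1] equally spaced
    windows of length [N] of a long word two coincide. *)
Require Import Defs.
From HB Require Import structures.
From mathcomp Require Import all_boot all_order all_algebra.
From mathcomp Require Import all_classical all_reals all_analysis.
From mathcomp Require Import ring lra zify.
Import Order.TTheory GRing.Theory Num.Theory.
Import numFieldNormedType.Exports.
Set Implicit Arguments.
Unset Strict Implicit.
Unset Printing Implicit Defensive.
Local Open Scope classical_set_scope.
Local Open Scope ring_scope.

(** * Words with repeated windows *)

Section Windows.
Local Open Scope nat_scope.
Variables (A : finType) (n p : nat) (D : {set n.-tuple A}).
Implicit Types (f g : nat -> A).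

(** Words are functions on [nat], so that finite words continued by a default letter and periodic
    words share one treatment. *)
Definition win f (s : nat) : n.-tuple A := [tuple f (s + val j) | j < n].

(** [D] holds windows already paid for: none in the first moment, those of the other word of a pair
    in the second. *)
Definition repeated f (s : nat) : bool :=
  (win f s \in D) || [exists t : 'I_s, win f s == win f t].

Definition free_at f (i : nat) : bool :=
  [forall s : 'I_p, repeated f s ==> ~~ ((s <= i) && (i < s + n))].

(* A repetition at [s] is witnessed either by the rank of an element of [D] or
   by [#|D| + t], where [t] is an earlier starting position. *)
Definition witness f (s k : nat) : Prop :=
  k < #|D| + s /\
  win f s = (if k < #|D| then nth (win f s) (enum D) k else win f (k - #|D|)).

Lemma win_eqP f g s t :
  reflect (forall j, j < n -> f (s + j) = g (t + j)) (win f s == win g t).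
Proof.
apply: (iffP eqP) => [e j jn|e].
- have := congr1 (fun u => tnth u (Ordinal jn)) e.
  by rewrite !tnth_mktuple.
- by apply: eq_from_tnth => j; rewrite !tnth_mktuple; apply: e; exact: ltn_ord.
Qed.

Lemma repeatedP f s : reflect (exists k, witness f s k) (repeated f s).
Proof.
apply: (iffP orP) => [[sD|/existsP[t /eqP e]]|[k [ks e]]].
- exists (index (win f s) (enum D)); split.
    by apply: ltn_addr; rewrite cardE index_mem mem_enum.
  by rewrite cardE index_mem mem_enum sD nth_index // mem_enum.
- exists (#|D| + t); split; first by rewrite ltn_add2l.
  by rewrite ltnNge leq_addr /= addKn.
- move: e; case: ltnP => [kD e|Dk e].
    by left; rewrite e -mem_enum mem_nth // -cardE.
  right; apply/existsP.
  have ts : k - #|D| < s by lia.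
  by exists (Ordinal ts); apply/eqP.
Qed.

Lemma not_freeP f i :
  reflect (exists s, [/\ s < p, repeated f s, s <= i & i < s + n]) (~~ free_at f i).
Proof.
apply: (iffP forallPn) => [[s]|[s [sp rs si ins]]].
  by rewrite negb_imply negbK => /andP[rs /andP[? ?]]; exists s.
by exists (Ordinal sp); rewrite negb_imply rs negbK si ins.
Qed.

Definition cell_word f (J : nat) : seq A :=
  [seq f i | i <- iota (J * n) n & (i < p) && free_at f i].

(** [None] stands for a cell where no repeated window starts. Otherwise each pair is an offset and a
    witness, for the first and for the last repeated window starting in the cell. *)
Definition cell_code : finType :=
  option (('I_n * 'I_(#|D| + p)) * ('I_n * 'I_(#|D| + p)))%type.

Definition codes f (J : nat) (c : cell_code) : Prop :=
  match c with
  | None => forall s, s < p -> J * n <= s < J * n + n -> ~~ repeated f s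
  | Some (a, b) =>
     [/\ [/\ J * n + a.1 < p, witness f (J * n + a.1) a.2,
             J * n + b.1 < p & witness f (J * n + b.1) b.2] &
     forall s, s < p -> J * n <= s < J * n + n -> repeated f s ->
       J * n + a.1 <= s <= J * n + b.1]
  end.

Lemma codes_ex f J : exists c, codes f J c.
Proof.
pose P s := [&& s < p, J * n <= s < J * n + n & repeated f s].
have [[s0 Ps0]|nP] := pselect (exists s, P s); last first.
  exists None => s sp sJ; apply/negP => rs.
  by apply: nP; exists s; rewrite /P sp sJ rs.
have exP : exists s, P s by exists s0.
have ubP s : P s -> s <= p by case/and3P=> /ltnW.
have [s1 P1 min1] := ex_minnP exP.
have [s2 P2 max2] := ex_maxnP exP ubP.
have enc s : P s -> exists a : 'I_n * 'I_(#|D| + p),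
    J * n + a.1 = s /\ witness f s a.2.
  case/and3P=> sp /andP[Js sJ] /repeatedP[k wk].
  have on : s - J * n < n by lia.
  have kq : k < #|D| + p by case: wk; lia.
  by exists (Ordinal on, Ordinal kq); rewrite /= subnKC.
have [a [ea wa]] := enc _ P1.
have [b [eb wb]] := enc _ P2.
exists (Some (a, b)); rewrite /codes ea eb.
case/and3P: P1 => sp1 _ _; case/and3P: P2 => sp2 _ _.
by split=> // s sp sJ rs; rewrite min1 ?max2 // /P sp sJ rs.
Qed.

(* The windows starting at the first and at the last repetition of a cell
   cover all the repeated windows starting in this cell. *)
Lemma common_witness (C : nat) f g (c : nat -> cell_code) :
    0 < n -> p <= C * n ->
    (forall J, J < C -> codes f J (c J)) -> (forall J, J < C -> codes g J (c J)) ->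
  forall i, ~~ free_at f i -> exists s k,
    [/\ s < p, s <= i < s + n, witness f s k & witness g s k].
Proof.
move=> n0 pC cf cg i /not_freeP[s [sp rs si isn]].
have JC : s %/ n < C by rewrite ltn_divLR //; lia.
have := cf _ JC; have := cg _ JC; set J := s %/ n.
have sJ : J * n <= s < J * n + n.
  by rewrite leq_divM /= addnC -mulSn ltn_ceil.
case: (c J) => [[[x1 k1] [x2 k2]]|] /=; last first.
  by move=> _ /(_ s sp sJ); rewrite rs.
move=> [[ap wga bp wgb] _] [[_ wfa _ wfb] /(_ s sp sJ rs) /andP[as_ sb]].
move: (ltn_ord x1) (ltn_ord x2) => x1n x2n.
(* Offsets are below [n], so a position past the first window lies past the start of the last one,
   which ends no earlier than the window at [s]. *)
have [ia|ia] := ltnP i (J * n + x1 + n).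
  by exists (J * n + x1), k1; split=> //; rewrite ia (leq_trans as_ si).
exists (J * n + x2), k2; split=> //; clear -as_ sb ia isn x1n x2n si; lia.
Qed.

(** Letters are recovered from left to right: a free one is read in its cell word; any other lies in
    a window copied from [D] or from an earlier start, hence equals a known letter even if the two
    windows overlap. *)
Lemma cell_decode (C : nat) f g (c : nat -> cell_code) :
    0 < n -> p <= C * n ->
    (forall J, J < C -> codes f J (c J)) -> (forall J, J < C -> codes g J (c J)) ->
    (forall J, J < C -> cell_word f J = cell_word g J) ->
  forall i, i < p -> f i = g i.
Proof.
move=> n0 pC cf cg ew.
(* Common codes force common free positions, so the two cell words of a cell list letters at the
   same places. *)
have cvr f1 f2 : (forall J, J < C -> codes f1 J (c J)) ->
    (forall J, J < C -> codes f2 J (c J)) -> forall i, free_at f1 i -> free_at f2 i.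
  move=> c1 c2 i; apply: contraLR => /(common_witness n0 pC c2 c1).
  move=> [s [k [sp /andP[si isn] _ w1]]]; apply/not_freeP; exists s; split=> //.
  by apply/repeatedP; exists k.
have efree i : free_at f i = free_at g i by apply/idP/idP; apply: cvr.
elim/ltn_ind => i IH ip.
have [fi|nfi] := boolP (free_at f i); last first.
  have [s [k [sp /andP[si isn] [ks wf] [_ wg]]]] :=
    common_witness n0 pC cf cg nfi.
  have jn : i - s < n by lia.
  have letter h : h i = tnth (win h s) (Ordinal jn).
    by rewrite tnth_mktuple /= subnKC.
  rewrite (letter f) (letter g) wf wg; case: ltnP => kD.
    by congr tnth; apply: set_nth_default; rewrite -cardE.
  rewrite !tnth_mktuple /=; have kd : k - #|D| < s by rewrite ltn_subLR.
  by apply: IH; last apply: ltn_trans ip; rewrite -[ltnRHS](subnKC si) ltn_add2r.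
have JC : i %/ n < C by rewrite ltn_divLR //; lia.
have iJ : i \in iota (i %/ n * n) n.
  by rewrite mem_iota leq_divM /= addnC -mulSn ltn_ceil.
move: (ew _ JC); rewrite /cell_word.
under [in RHS]eq_filter do rewrite -efree.
by move/eq_in_map; apply; rewrite mem_filter ip fi iJ.
Qed.

(** A window that contains [j] but neither [i] nor [k] would fit strictly between two positions of
    one cell, which has only [n] positions. *)
Lemma free_convex f J i j k : free_at f i -> free_at f k -> J * n <= i -> i < j ->
  j < k -> k < J * n + n -> free_at f j.
Proof.
move=> fi fk Ji ij jk kJ; apply: contraT => /not_freeP[s [sp rs sj jsn]].
have /forallP/(_ (Ordinal sp)) := fi; have /forallP/(_ (Ordinal sp)) := fk.
by rewrite /= rs /=; lia.
Qed.

Lemma filter_iota_convex (P : pred nat) a l :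
    (forall i j k, P i -> P k -> a <= i -> i < j -> j < k -> k < a + l -> P j) ->
  exists b m, [seq i <- iota a l | P i] = iota b m /\ b + m <= a + l.
Proof.
elim: l a => [|l IH] a conv; first by exists a, 0; split.
have [|b [m [e bm]]] := IH a.+1.
  by move=> i j k Pi Pk ai ij jk kl; apply: (conv i j k) => //; lia.
rewrite /= e; case: ifP => Pa; last by exists b, m; split=> //; lia.
have [->|m0] := posnP m; first by exists a, 1; split=> //; lia.
have mem i : (i \in iota b m) = P i && (i \in iota a.+1 l).
  by rewrite -e mem_filter.
have := mem b; rewrite !mem_iota => Pb.
have {}Pb : P b /\ a.+1 <= b by lia.
have [->|ba] := eqVneq b a.+1; first by exists a, m.+1; split=> //; lia.
have Pa1 : P a.+1 by apply: (conv a a.+1 b) => //; lia.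
by have := mem a.+1; rewrite !mem_iota Pa1; lia.
Qed.

(** Convexity makes the cell word a factor of the word, hence a word of the language. The case
    [m = 0] covers an empty cell word, whose start is arbitrary. *)
Lemma cell_word_subword f J : exists b m,
  cell_word f J = [seq f i | i <- iota b m] /\ (b + m <= p \/ m = 0).
Proof.
rewrite /cell_word; have [i j k|b [m [e bm]]] :=
  @filter_iota_convex (fun i => (i < p) && free_at f i) (J * n) n.
  move=> /andP[_ fi] /andP[kp fk] ai ij jk kl; apply/andP; split; first by lia.
  exact: (@free_convex f J i j k).
exists b, m; rewrite e; split=> //.
have [->|m0] := posnP m; first by right.
left; have : b + m.-1 \in iota b m by rewrite mem_iota; lia.
by rewrite -e mem_filter => /andP[/andP[]]; lia.
Qed.

Lemma size_cell_word f J : size (cell_word f J) <= n.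
Proof. by rewrite size_map size_filter (leq_trans (count_size _ _)) ?size_iota. Qed.

Lemma sum_size_cell_word f C :
  \sum_(J < C) size (cell_word f J) =
  size [seq i <- iota 0 (C * n) | (i < p) && free_at f i].
Proof.
elim: C => [|C IH]; first by rewrite big_ord0.
by rewrite big_ord_recr /= IH mulSnr iotaD filter_cat size_cat add0n size_map.
Qed.

(** A repeated window covers its own start, so the windows at free positions below [p] are not
    repeated: they avoid [D] and are pairwise distinct. *)
Lemma new_windows f C : 0 < n ->
  \sum_(J < C) size (cell_word f J) <= #|[set win f (val s) | s : 'I_p] :\: D|.
Proof.
move=> n0; rewrite sum_size_cell_word.
set F := [seq i <- _ | _].
have uF : uniq [seq win f i | i <- F].
  rewrite map_inj_in_uniq ?filter_uniq ?iota_uniq // => i j.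
  rewrite !mem_filter => /andP[/andP[ip fi] _] /andP[/andP[jp fj] _] e.
  have nrep k : k < p -> free_at f k -> ~~ repeated f k.
    move=> kp /forallP/(_ (Ordinal kp)) /=.
    by apply: contraL => ->; rewrite /= leqnn -{1}(addn0 k) ltn_add2l n0.
  case: (ltngtP i j) => // ij; [have := nrep j jp fj|have := nrep i ip fi].
    by case/negP; apply/orP; right; apply/existsP; exists (Ordinal ij); rewrite e.
  by case/negP; apply/orP; right; apply/existsP; exists (Ordinal ij); rewrite e.
rewrite -(size_map (win f) F) -(card_uniqP uF); apply: subset_leq_card.
apply/fintype.subsetP => w /mapP[i]; rewrite mem_filter => /andP[/andP[ip fi] _] ->.
rewrite !inE; apply/andP; split; last by apply/imsetP; exists (Ordinal ip).
have /forallP/(_ (Ordinal ip)) /= := fi.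
by apply: contraL => wD; rewrite /repeated wD /= leqnn -{1}(addn0 i) ltn_add2l n0.
Qed.

End Windows.

(** * Weighted counting of words through their codes *)

Lemma card_cell_code (A : finType) (n p : nat) (D : {set n.-tuple A}) :
  #|cell_code p D| = ((n * (#|D| + p)) ^ 2).+1%N.
Proof. by rewrite card_option !card_prod !card_ord mulnn. Qed.

(** Codes and cell words determine the word, and it has at least as many new windows as letters in
    its cell words. As [alpha <= 1], its weight is at most a product over cells, and the sum over
    all data factorizes. [good] keeps what is known of each cell word. *)
Lemma weighted_count (R : realType) (A I : finType) (n p C : nat)
    (D : {set n.-tuple A}) (ev : I -> nat -> A) (Y : {set I})
    (good : 'I_C -> pred (seq A)) (alpha : R) :
    (0 < n)%N -> (p <= C * n)%N -> 0 <= alpha <= 1 ->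
    {in Y &, forall y z, (forall i, (i < p)%N -> ev y i = ev z i) -> y = z} ->
    {in Y, forall y (J : 'I_C), good J (cell_word p D (ev y) J)} ->
  \sum_(y in Y) alpha ^+ #|[set win n (ev y) (val s) | s : 'I_p] :\: D| <=
  \prod_(J < C) ((((n * (#|D| + p)) ^ 2).+1)%:R *
                 \sum_(w : n.-bseq A | good J w) alpha ^+ size w).
Proof.
move=> n0 pC /andP[a0 a1] inj gd.
have [c cP] := choice (fun yJ : I * nat => codes_ex p D (ev yJ.1) yJ.2).
pose dat (y : I) : {ffun 'I_C -> cell_code p D * n.-bseq A} :=
  [ffun J : 'I_C => (c (y, val J), Bseq (size_cell_word p D (ev y) J))].
pose wt (J : 'I_C) (u : cell_code p D * n.-bseq A) : R := alpha ^+ size u.2.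
have dat_inj : {in Y &, injective dat}.
  move=> y z yY zY e; apply: inj => //.
  have eJ (J : 'I_C) : c (y, val J) = c (z, val J) /\
      cell_word p D (ev y) J = cell_word p D (ev z) J.
    by have /ffunP/(_ J) := e; rewrite !ffunE => -[-> ->].
  apply: (@cell_decode _ n p D C _ _ (fun J => c (y, J))) => //.
  - by move=> J _; exact: (cP (y, J)).
  - move=> J JC; have [/= -> _] := eJ (Ordinal JC); exact: (cP (z, J)).
  - by move=> J JC; have [] := eJ (Ordinal JC).
apply: (@le_trans _ _ (\sum_(y in Y) \prod_J wt J (dat y J))).
  apply: ler_sum => y yY.
  have -> : \prod_J wt J (dat y J) =
            alpha ^+ (\sum_(J < C) size (cell_word p D (ev y) J))%N.
    by rewrite -prodrXr; apply: eq_bigr => J _; rewrite /wt ffunE.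
  by rewrite ler_wiXn2l // new_windows.
rewrite -(big_imset (fun f : {ffun _ -> _} => \prod_J wt J (f J)) dat_inj) /=.
pose goods J (u : cell_code p D * n.-bseq A) := good J (val u.2).
(* Enlarging the image of [Y] to all families of good data only adds nonnegative terms and allows
   distributivity. *)
apply: (@le_trans _ _ (\sum_(f in family goods) \prod_J wt J (f J))).
  rewrite [leRHS](bigID (fun f => f \in dat @: Y)) /=.
  rewrite (eq_bigl (fun f => (f \in family goods) && (f \in dat @: Y))).
    rewrite lerDl sumr_ge0 // => f _; apply: prodr_ge0 => J _; exact: exprn_ge0.
  move=> f; case: imsetP; rewrite ?andbF // => -[y yY ->]; rewrite andbT.
  by symmetry; apply/familyP => J; rewrite ffunE; exact: gd.
rewrite -(bigA_distr_big_dep _ (fun J u => wt J u)) /=.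
apply: ler_prod => J _; rewrite sumr_ge0 /=; last by move=> u _; exact: exprn_ge0.
rewrite -(pair_big xpredT (fun w : n.-bseq A => good J w)
  (fun (_ : cell_code p D) (w : n.-bseq A) => alpha ^+ size w)) /=.
by rewrite sumr_const -card_cell_code mulr_natl.
Qed.

(** * Random subsets *)

Section RandomSubset.
Variables (R : realType) (T : finType) (B : {set T}) (alpha : R).
Hypotheses (alpha_ge0 : 0 <= alpha) (alpha_le1 : alpha <= 1).

Definition subset_weight (omega : {set T}) : R :=
  \prod_(w in B) (if w \in omega then alpha else 1 - alpha).

Definition mean (f : {set T} -> R) : R :=
  \sum_(omega in powerset B) subset_weight omega * f omega.

Definition prob (E : set {set T}) : R :=
  \sum_(omega in powerset B | `[< E omega >]) subset_weight omega.

Lemma subset_weight_ge0 omega : 0 <= subset_weight omega.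
Proof. by apply: prodr_ge0 => w _; case: ifP => _; rewrite ?subr_ge0. Qed.

(** The mean is the expansion over subsets of the product of all [F i + G i]: [F] vanishes outside
    [B], which kills the sets not contained in [B], and [G] vanishes on [W], which kills those not
    containing [W]. *)
Lemma mean_superset (W : {set T}) : W \subset B ->
  mean (fun omega : {set T} => (W \subset omega)%:R) = alpha ^+ #|W|.
Proof.
move=> WB; pose F i := if i \in B then alpha else 0.
pose G i := if i \in B then (if i \in W then 0 else 1 - alpha) else 1.
have <- : \prod_i (F i + G i) = alpha ^+ #|W|.
  rewrite (bigID [in W]) /= [X in _ * X]big1 ?mulr1 => [|i iW].
    rewrite -prodr_const; apply: eq_bigr => i iW.
    by rewrite /F /G (fintype.subsetP WB _ iW) iW addr0.
  by rewrite /F /G (negbTE iW); case: ifP => _; rewrite ?add0r // addrC subrK.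
rewrite bigA_distr (bigID (fun J => J \in powerset B)) /=.
rewrite [X in _ + X]big1 ?addr0 => [|J]; last first.
  rewrite powersetE => /subsetPn[i iJ iB].
  by rewrite (bigD1 i) //= iJ /F (negbTE iB) mul0r.
apply: eq_bigr => J; rewrite powersetE => JB.
rewrite [RHS](bigID [in B]) /= [X in _ = _ * X]big1 ?mulr1 => [|i iB]; last first.
  by rewrite /G (negbTE iB) ifF //; apply/negP => /(fintype.subsetP JB) iB'; rewrite iB' in iB.
have [WJ|/subsetPn[i iW iJ]] := boolP (W \subset J).
  rewrite mulr1; apply: eq_bigr => i iB; rewrite /F /G iB.
  have [//|iJ] := boolP (i \in J).
  by rewrite ifF //; apply/negP => /(fintype.subsetP WJ) iJ'; rewrite iJ' in iJ.
have iB := fintype.subsetP WB _ iW.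
by rewrite mulr0 (bigD1 i) //= (negbTE iJ) /G iB iW mul0r.
Qed.

Lemma mean_sum (I : finType) (P : pred I) (f : I -> {set T} -> R) :
  mean (fun omega : {set T} => \sum_(i | P i) f i omega) = \sum_(i | P i) mean (f i).
Proof.
rewrite /mean exchange_big /=; apply: eq_bigr => omega _; by rewrite mulr_sumr.
Qed.

Lemma markov_subset (E : set {set T}) (f : {set T} -> R) (t : R) : 0 < t ->
    (forall omega, 0 <= f omega) ->
    (forall omega : {set T}, omega \subset B -> E omega -> t <= f omega) ->
  prob E <= mean f / t.
Proof.
move=> t0 f0 Ef; rewrite ler_pdivlMr // /prob /mean mulr_suml.
rewrite [leRHS](bigID (fun omega : {set T} => `[< E omega >])) /=.
apply: ler_wpDr.
  by apply: sumr_ge0 => omega _; rewrite mulr_ge0 ?subset_weight_ge0.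
apply: ler_sum => omega /andP[oB /asboolP Eo].
by rewrite ler_wpM2l ?subset_weight_ge0 // Ef // -powersetE.
Qed.

Lemma prob_ge0 E : 0 <= prob E.
Proof. by apply: sumr_ge0 => omega _; exact: subset_weight_ge0. Qed.

Lemma prob_le (E E1 : set {set T}) :
    (forall omega : {set T}, omega \subset B -> E omega -> E1 omega) ->
  prob E <= prob E1.
Proof.
move=> sub; rewrite /prob !big_mkcondr /=.
apply: ler_sum => omega; rewrite powersetE => oB.
case: asboolP => [/(sub _ oB) h|_]; first by rewrite (asboolT h).
by case: ifP => // _; exact: subset_weight_ge0.
Qed.

Lemma prob_union (E E1 E2 : set {set T}) :
    (forall omega : {set T}, omega \subset B -> E omega -> E1 omega \/ E2 omega) ->
  prob E <= prob E1 + prob E2.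
Proof.
move=> sub; rewrite /prob !big_mkcondr /= -big_split /=.
apply: ler_sum => omega; rewrite powersetE => oB.
have w0 := subset_weight_ge0 omega.
case: asboolP => [/(sub _ oB) E12|_]; last by do 2 case: ifP => _; lra.
by case: E12 => h; rewrite (asboolT h); case: ifP => _; lra.
Qed.

(* Second moment method: only pairs sharing an element contribute to the
   variance of the number of sets [W x] contained in the random set. *)
Lemma second_moment (I : finType) (Y : {set I}) (W : I -> {set T})
    (Theta : R) (E : set {set T}) :
    {in Y, forall x, W x \subset B} ->
    {in Y, forall x, \sum_(y in Y | ~~ [disjoint W x & W y])
                        alpha ^+ #|W y :\: W x| <= Theta} ->
    let tau := \sum_(x in Y) alpha ^+ #|W x| in
    0 < tau ->
    (forall omega : {set T}, omega \subset B -> E omega ->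
       #|[set x in Y | W x \subset omega]|%:R <= tau / 2) ->
  prob E <= 4 * Theta / tau.
Proof.
move=> WB hTheta tau.
have tauE : tau = \sum_(x in Y) alpha ^+ #|W x| by [].
clearbody tau; move=> tau0 hE.
pose N (omega : {set T}) : R := #|[set x in Y | W x \subset omega]|%:R.
have NE omega : N omega = \sum_(x in Y) (W x \subset omega)%:R.
  by rewrite /N -sum1_card natr_sum big_mkcond [RHS]big_mkcond /=; apply: eq_bigr => x _;
    rewrite inE; case: (x \in Y) => //=; case: (W x \subset omega).
have mean1 : mean (fun=> 1) = 1.
  rewrite -[RHS](expr0 alpha) -(cards0 T) -mean_superset ?finset.sub0set //.
  by apply: eq_bigr => o _; rewrite finset.sub0set.
have meanN : mean N = tau.
  transitivity (mean (fun omega : {set T} => \sum_(x in Y) (W x \subset omega)%:R)).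
    by apply: eq_bigr => o _; rewrite NE.
  by rewrite mean_sum tauE; apply: eq_bigr => x xY; rewrite mean_superset ?WB.
have meanN2 : mean (fun o => N o ^+ 2) =
    \sum_(x in Y) \sum_(y in Y) alpha ^+ #|W x :|: W y|.
  transitivity (mean (fun omega : {set T} =>
      \sum_(x in Y) \sum_(y in Y) (W x :|: W y \subset omega)%:R)).
    apply: eq_bigr => o _; congr (_ * _).
    rewrite NE expr2 mulr_suml; apply: eq_bigr => x _.
    rewrite mulr_sumr; apply: eq_bigr => y _.
    by rewrite finset.subUset -natrM mulnb.
  rewrite mean_sum; apply: eq_bigr => x xY.
  rewrite mean_sum; apply: eq_bigr => y yY.
  by rewrite mean_superset // finset.subUset !WB.
have var : mean (fun o => (N o - tau) ^+ 2) <= tau * Theta.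
  have -> : mean (fun o => (N o - tau) ^+ 2) = mean (fun o => N o ^+ 2) - tau ^+ 2.
    transitivity (mean (fun o => N o ^+ 2) - 2 * tau * mean N + tau ^+ 2 * mean (fun=> 1)).
      rewrite /mean !mulr_sumr -sumrN -!big_split /=.
      apply: eq_bigr => o _; ring.
    by rewrite mean1 meanN; ring.
  have eR : tau * Theta = \sum_(x in Y) alpha ^+ #|W x| * Theta.
    by rewrite tauE mulr_suml.
  have eL : tau ^+ 2 = \sum_(x in Y) alpha ^+ #|W x| * tau.
    by rewrite expr2 {1}tauE mulr_suml.
  rewrite meanN2 eL eR -sumrB; apply: ler_sum => x xY.
  rewrite tauE mulr_sumr -sumrB.
  (* Disjoint pairs cancel exactly; for the other pairs the product of the means is dropped. *)
  apply: (@le_trans _ _ (\sum_(y in Y | ~~ [disjoint W x & W y])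
                alpha ^+ #|W x| * alpha ^+ #|W y :\: W x|)).
    rewrite [leRHS]big_mkcondr /=; apply: ler_sum => y yY.
    have -> : #|W x :|: W y| = (#|W x| + #|W y :\: W x|)%N.
      rewrite cardsU cardsD [W y :&: _]finset.setIC.
      by have := subset_leq_card (finset.subsetIr (W x) (W y)); lia.
    rewrite exprD; case: ifPn => [_|/negPn dxy].
      by rewrite gerBl mulr_ge0 ?exprn_ge0.
    suff -> : W y :\: W x = W y by rewrite subrr.
    by apply/finset.setDidPl; rewrite disjoint_sym.
  by rewrite -mulr_sumr ler_wpM2l ?exprn_ge0 ?hTheta.
(* Chebyshev's inequality: on [E] the count deviates from its mean [tau] by at least [tau / 2]. *)
have t2 : 0 < (tau / 2) ^+ 2 by rewrite exprn_gt0 // divr_gt0.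
apply: (le_trans (@markov_subset E (fun o => (N o - tau) ^+ 2) _ t2 _ _)).
- by move=> o; exact: sqr_ge0.
- move=> o oB Eo; have := hE _ oB Eo; rewrite -/(N o) => Nt.
  by rewrite -(sqrrN (N o - tau)) opprB ler_sqr ?nnegrE; lra.
- rewrite ler_pdivrMr //; apply: (le_trans var).
  by rewrite le_eqVlt; apply/orP; left; apply/eqP; field; rewrite gt_eqF.
Qed.

End RandomSubset.

(** * Entropy *)

(** Here [h] is the infimum of [u m / m] over positive [m]. Explicit linear bounds replace the limit
    because later estimates are made at finite lengths. *)
Lemma fekete (R : realType) (u : nat -> R) :
    (forall m n, u (m + n)%N <= u m + u n) -> (forall n, 0 <= u n) ->
  exists h : R, [/\ 0 <= h, (forall m, h * m%:R <= u m) &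
    forall delta : R, 0 < delta ->
      exists K : R, forall l, u l <= (h + delta) * l%:R + K].
Proof.
move=> sub u0.
have uM m n : u (n * m)%N <= n%:R * u m + u 0%N.
  elim: n => [|n IH]; first by rewrite mul0n mul0r add0r.
  rewrite mulSn -natr1; apply: (le_trans (sub _ _)); lra.
pose S := [set u m.+1 / m.+1%:R | m in [set: nat]].
have lbS : lbound S 0 by move=> _ [m _ <-]; rewrite divr_ge0.
have infS : has_inf S by split; [exists (u 1%N / 1%:R), 0%N|exists 0].
exists (inf S); split.
- by apply: lb_le_inf => //; exact: infS.1.
- case=> [|m]; first by rewrite mulr0.
  rewrite -ler_pdivlMr ?ltr0n //; apply: ge_inf; first by exists 0.
  by exists m.
- move=> delta d0.
  have [_ [m _ <-] hm] := inf_adherent d0 infS.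
  (* The remainder modulo [m.+1] costs at most [m.+1] copies of [u 1]; the two terms [u 0] come from
     the two uses of [uM]. *)
  exists (m.+1%:R * u 1%N + u 0%N + u 0%N) => l.
  have h0 : 0 <= inf S by apply: lb_le_inf => //; exact: infS.1.
  have {1}-> : l = (l %/ m.+1 * m.+1 + l %% m.+1)%N by exact: divn_eq.
  apply: (le_trans (sub _ _)).
  have := uM m.+1 (l %/ m.+1)%N; have := uM 1%N (l %% m.+1)%N; rewrite muln1.
  have r1 : (l %% m.+1)%:R * u 1%N <= m.+1%:R * u 1%N.
    by rewrite ler_wpM2r // ler_nat ltnW // ltn_mod.
  have r2 : (l %/ m.+1)%:R * u m.+1 <= (inf S + delta) * l%:R.
    apply: (@le_trans _ _ ((inf S + delta) * (l %/ m.+1 * m.+1)%:R)).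
      rewrite natrM mulrCA; apply: ler_wpM2l => //.
      by rewrite -ler_pdivrMr ?ltr0n // ltW.
    by apply: ler_wpM2l; [lra|rewrite ler_nat leq_divM].
  lra.
Qed.

(** * Languages and bounds on word counts at finite lengths *)

Section Language.
Variable A : finType.
Implicit Types (X Z : set (int -> A)) (x : int -> A).

Definition in_language X (w : seq A) : bool := `[< exists2 x, X x & appears w x >].

Lemma mem_language X n (w : n.-tuple A) : (w \in language X n) = in_language X w.
Proof. by rewrite inE. Qed.

Lemma val_win n (f : nat -> A) b : win n f b = [seq f j | j <- iota b n] :> seq A.
Proof.
rewrite /win /= -{2}(addn0 b) iotaDl -map_comp -val_enum_ord -map_comp.
exact: eq_map.
Qed.

Lemma word_at_win x i n : word_at x i n = win n (fun j => x (i + j%:Z)) 0.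
Proof. by apply: eq_from_tnth => j; rewrite !tnth_mktuple. Qed.

Lemma nth_win a n (f : nat -> A) b j : (j < n)%N -> nth a (win n f b) j = f (b + j)%N.
Proof. by move=> jn; rewrite -(tnth_nth _ _ (Ordinal jn)) tnth_mktuple. Qed.

Lemma appearsP a (w : seq A) x :
  appears w x <-> exists i : int, forall j, (j < size w)%N -> nth a w j = x (i + j%:Z).
Proof.
split=> -[i e]; exists i.
  by move=> j jw; rewrite e word_at_win nth_win.
apply: (@eq_from_nth _ a); first by rewrite size_tuple.
by move=> j jw; rewrite e // word_at_win nth_win.
Qed.

Lemma appears_win a (w : seq A) x b l : (b + l <= size w)%N -> appears w x ->
  appears (win l (nth a w) b) x.
Proof.
move=> bl /(appearsP a)[i e]; apply/(appearsP a); exists (i + b%:Z) => j.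
rewrite size_tuple => jl; rewrite nth_win // e; last by lia.
by congr x; lia.
Qed.

Lemma language_win X a (w : seq A) b l : (b + l <= size w)%N -> in_language X w ->
  win l (nth a w) b \in language X l.
Proof.
move=> bl /asboolP[x Xx wx]; rewrite mem_language; apply/asboolP; exists x => //.
exact: appears_win.
Qed.

Lemma tuple_nth_inj a m (w w' : m.-tuple A) :
  (forall j, (j < m)%N -> nth a w j = nth a w' j) -> w = w'.
Proof. by move=> e; apply: eq_from_tnth => j; rewrite !(tnth_nth a) e. Qed.

Lemma card_language_gt0 X n : X !=set0 -> (0 < #|language X n|)%N.
Proof.
move=> [x Xx]; apply/card_gt0P; exists (word_at x 0 n); rewrite mem_language.
by apply/asboolP; exists x => //; exists 0; rewrite size_tuple.
Qed.

Lemma card_language_add (a : A) X m n :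
  (#|language X (m + n)| <= #|language X m| * #|language X n|)%N.
Proof.
pose cut (w : (m + n).-tuple A) := (win m (nth a w) 0, win n (nth a w) m).
have cut_inj : injective cut.
  move=> w w' [/eqP/win_eqP e1 /eqP/win_eqP e2].
  apply: (@tuple_nth_inj a) => j jmn; have [jm|mj] := ltnP j m; first exact: e1.
  by rewrite -(subnKC mj); apply: e2; lia.
rewrite -cardsX -(card_imset _ cut_inj); apply: subset_leq_card.
apply/fintype.subsetP => _ /imsetP[w wX ->]; rewrite mem_language in wX.
by rewrite inE /= !language_win // size_tuple; lia.
Qed.

(** Fekete's lemma for the logarithm of the word count, which is subadditive because a word is given
    by its two pieces. *)
Lemma entropy_nonempty (R : realType) X : X !=set0 ->
  exists h : R, [/\ entropy R X = h%:E, 0 <= h,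
    (forall m, expR (h * m%:R) <= #|language X m|%:R) &
    forall delta : R, 0 < delta -> exists2 K : R, 0 < K &
      forall l, #|language X l|%:R <= K * expR ((h + delta) * l%:R)].
Proof.
move=> X0; have [x Xx] := X0; have a := x 0.
have b0 n : 0 < #|language X n|%:R :> R by rewrite ltr0n card_language_gt0.
pose u n : R := ln #|language X n|%:R.
have [m n|n|h [h0 hle hub]] := @fekete R u.
- rewrite /u -lnM ?posrE // ler_ln ?posrE ?mulr_gt0 //.
  by rewrite -natrM ler_nat card_language_add.
- by rewrite ln_ge0 // ler1n card_language_gt0.
exists h; split=> //.
- apply/cvg_lim => //.
  have -> : (fun n => (n%:R^-1)%:E * lne (#|language X n|%:R)%:E)%E =
            (fun n => (n%:R^-1 * u n)%:E).
    by apply: funext => n; rewrite lne_EFin // EFinM.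
  apply: cvg_EFin; first by near=> n.
  apply/cvgrPdist_le => e e0.
  have [K hK] := hub (e / 2) ltac:(lra).
  near=> n.
  have n0 : 0 < n%:R :> R by near: n; exact: nbhs_infty_gtr.
  have nK : 2 * K / e <= n%:R by near: n; exact: nbhs_infty_ger.
  rewrite ler_pdivrMr // in nK.
  rewrite /= distrC ger0_norm; last first.
    by rewrite subr_ge0 mulrC ler_pdivlMr.
  rewrite lerBlDr mulrC ler_pdivrMr //; have := hK n; lra.
- move=> m; have -> : #|language X m|%:R = expR (u m) by rewrite lnK ?posrE.
  by rewrite ler_expR.
- move=> delta /hub[K hK]; exists (expR K); first exact: expR_gt0.
  move=> l; have -> : #|language X l|%:R = expR (u l) by rewrite lnK ?posrE.
  by rewrite -expRD ler_expR addrC.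
Unshelve. all: by end_near.
Qed.

Lemma entropy_empty (R : realType) X : ~ (X !=set0) -> entropy R X = -oo%E.
Proof.
move=> X0; apply: lim_near_cst => //; near=> n.
have -> : #|language X n| = 0%N.
  apply/eqP; rewrite cards_eq0; apply/eqP/setP => w; rewrite mem_language inE.
  by apply/negP => /asboolP[x Xx _]; apply: X0; exists x.
by rewrite le0_lneNy // gt0_muleNy // lte_fin invr_gt0; near: n; exact: nbhs_infty_gtr.
Unshelve. all: by end_near.
Qed.

(** The upper bound on word counts holds at every length, so a lower bound along the multiples of a
    single [p] suffices. *)
Lemma entropy_ge (R : realType) X p (g : R) : (0 < p)%N ->
    (forall j, expR (g * (j.+1 * p)%:R) <= #|language X (j.+1 * p)|%:R) ->
  (g%:E <= entropy R X)%E.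
Proof.
move=> p0 hg.
have X0 : X !=set0.
  have : #|language X (1 * p)| != 0%N.
    by rewrite -(pnatr_eq0 R) gt_eqF // (lt_le_trans _ (hg 0%N)) ?expR_gt0.
  rewrite cards_eq0 => /set0Pn[w]; rewrite mem_language => /asboolP[x Xx _].
  by exists x.
have [h [-> _ _ hub]] := entropy_nonempty R X0.
rewrite lee_fin leNgt; apply/negP => hg'.
have [K K0 hK] := hub ((g - h) / 2) ltac:(lra).
pose j := Num.bound `|2 * ln K / (g - h)|.
have jK : 2 * ln K / (g - h) < j%:R.
  exact: le_lt_trans (ler_norm _) (archi_boundP (normr_ge0 _)).
have := le_trans (hg j) (hK _); rewrite -{1}(lnK K0) -expRD ler_expR.
rewrite ltr_pdivrMr in jK; last by lra.
have : j%:R * (g - h) <= (j.+1 * p)%:R * (g - h).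
  by apply: ler_wpM2r; [lra|rewrite ler_nat; nia].
lra.
Qed.

End Language.

(** * Periodic words *)

Section Periodic.
Variables (A : finType) (a : A).
Implicit Types (X Z : set (int -> A)) (x : int -> A).

(** A presentation of [Z] by its allowed windows. It covers both [X], for large [n], and the random
    subshift. *)
Definition windowed Z n (O : {set n.-tuple A}) : Prop :=
  forall x, Z x <-> forall i, word_at x i n \in O.

(** Once [n] reaches the longest forbidden word, an occurrence of such a word sits inside a window,
    and that window appears in a point of [X]. *)
Lemma SFT_windowed X : is_SFT X ->
  exists N, forall n, (N <= n)%N -> windowed X (language X n).
Proof.
move=> [F ->]; set X' := avoiding F.
exists (\max_(w <- F) size w)%N => n hn x; split.
  move=> Xx i; rewrite mem_language; apply/asboolP; exists x => //.
  by exists i; rewrite size_tuple.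
move=> h w wF /(appearsP a)[i e].
have := h i; rewrite mem_language => /asboolP[x' X'x' ap].
have wn : (size w <= n)%N by apply: leq_trans hn; exact: leq_bigmax_seq.
apply: (X'x' w wF); have -> : w = win (size w) (nth a (word_at x i n)) 0.
  apply: (@eq_from_nth _ a); first by rewrite size_tuple.
  move=> j jw; rewrite nth_win // add0n word_at_win nth_win ?e //.
  exact: leq_trans wn.
by apply: appears_win => //; rewrite size_tuple.
Qed.

Lemma sub_SFT_windowed X n (omega : {set n.-tuple A}) :
  windowed X (language X n) -> omega \subset language X n ->
  windowed (sub_SFT X omega) omega.
Proof.
move=> wX oX x; split=> [[_ h] i|h].
  by apply: h; exists i; rewrite size_tuple.
split; first by apply/wX => i; exact: (fintype.subsetP oX).
move=> w [i e]; suff -> : w = word_at x i n by [].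
by apply: val_inj; rewrite /= e size_tuple.
Qed.

(** The periodic word indexed by [nat], as the windows require; [per_point] is the two-sided
    point. *)
Definition per_letter (y : seq A) (i : nat) : A := nth a y (i %% size y).

Definition per_point (y : seq A) (i : int) : A :=
  nth a y `|(i %% (size y)%:Z)%Z|%N.

Definition per_words Z p : {set p.-tuple A} :=
  [set y : p.-tuple A | `[< Z (per_point y) >]].

Lemma per_pointD p (y : p.-tuple A) (s : nat) (i : int) (j : nat) :
  (0 < p)%N -> (i %% p%:Z)%Z = s%:Z -> per_point y (i + j%:Z) = per_letter y (s + j).
Proof.
move=> p0 e; rewrite /per_point /per_letter size_tuple.
by rewrite -modzDml e -PoszD modz_nat.
Qed.

Lemma mem_per_words Z n (O : {set n.-tuple A}) p (y : p.-tuple A) :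
    (0 < p)%N -> windowed Z O ->
  (y \in per_words Z p) = [forall s : 'I_p, win n (per_letter y) s \in O].
Proof.
move=> p0 wZ; rewrite inE.
have wE (i : int) (s : nat) : (i %% p%:Z)%Z = s%:Z ->
    word_at (per_point y) i n = win n (per_letter y) s.
  move=> e; rewrite word_at_win; apply/eqP/win_eqP => j _.
  by rewrite add0n (per_pointD _ _ p0 e).
apply/asboolP/forallP => [/wZ h s|h].
  by rewrite -(wE s%:Z) // modz_nat modn_small.
apply/wZ => i; have i0 : 0 <= (i %% p%:Z)%Z by rewrite modz_ge0; lia.
have ip : (`|(i %% p%:Z)%Z| < p)%N.
  have := ltz_pmod i (d := p%:Z); lia.
rewrite (wE i `|(i %% p%:Z)%Z|%N); first exact: (h (Ordinal ip)).
by rewrite gez0_abs.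
Qed.

Lemma per_words_sub_language Z p : (0 < p)%N -> per_words Z p \subset language Z p.
Proof.
move=> p0; apply/fintype.subsetP => y.
rewrite inE mem_language => /asboolP Zy; apply/asboolP; exists (per_point y) => //.
apply/(appearsP a); exists 0 => j; rewrite size_tuple => jp.
by rewrite (@per_pointD p y 0%N 0 j p0) ?mod0z // add0n /per_letter size_tuple modn_small.
Qed.

Definition per_windows n p (y : p.-tuple A) : {set n.-tuple A} :=
  [set win n (per_letter y) (val s) | s : 'I_p].

Lemma per_words_windows Z n (O : {set n.-tuple A}) p (y : p.-tuple A) :
    (0 < p)%N -> windowed Z O ->
  (y \in per_words Z p) = (per_windows n y \subset O).
Proof.
move=> p0 wZ; rewrite (mem_per_words _ p0 wZ); apply/forallP/fintype.subsetP.
  by move=> h _ /imsetP[s _ ->]; exact: h.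
by move=> h s; apply: h; apply/imsetP; exists s.
Qed.

(** A window crossing into the next block sees only its first [n] letters, which all words of [G]
    share; so it equals a cyclic window of a single block. *)
Lemma card_concat Z n (O : {set n.-tuple A}) p (G : {set p.-tuple A}) j :
    (0 < p)%N -> (n <= p)%N -> windowed Z O -> G \subset per_words Z p ->
    {in G &, forall y z : p.-tuple A, forall i, (i < n)%N -> nth a y i = nth a z i} ->
  (#|G| ^ j.+1 <= #|per_words Z (j.+1 * p)|)%N.
Proof.
move=> p0 np wZ GZ agree.
have jp0 : (0 < j.+1 * p)%N by rewrite muln_gt0.
have blk i : (i < j.+1 * p -> i %/ p < j.+1)%N by rewrite ltn_divLR.
pose cat (g : {ffun 'I_j.+1 -> p.-tuple A}) : (j.+1 * p).-tuple A :=
  [tuple nth a (g (inord (val i %/ p))) (val i %% p) | i < j.+1 * p].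
have nth_cat g i : (i < j.+1 * p)%N ->
    nth a (cat g) i = nth a (g (inord (i %/ p))) (i %% p).
  by move=> ijp; rewrite -(tnth_nth _ _ (Ordinal ijp)) tnth_mktuple.
have cat_inj : injective cat.
  move=> g g' e; apply/ffunP => q; apply: (@tuple_nth_inj _ a) => r rp.
  have ij : (q * p + r < j.+1 * p)%N by have := ltn_ord q; nia.
  have := congr1 (fun y : seq A => nth a y (q * p + r)) (congr1 val e).
  by rewrite /= !nth_cat // divnMDl // (divn_small rp) addn0 modnMDl (modn_small rp) inord_val.
rewrite -[X in (_ ^ X)%N]card_ord -card_ffun_on -(card_imset _ cat_inj).
apply: subset_leq_card; apply/fintype.subsetP => _ /imsetP[g /ffun_onP gG ->].
rewrite (mem_per_words _ jp0 wZ); apply/forallP => s.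
pose q : 'I_j.+1 := inord (s %/ p).
have qE : (q : nat) = (s %/ p)%N by rewrite inordK // blk.
have rp : (s %% p < p)%N by rewrite ltn_mod.
have := fintype.subsetP GZ _ (gG q).
rewrite (mem_per_words _ p0 wZ) => /forallP/(_ (Ordinal rp)) /=.
suff -> : win n (per_letter (g q)) (s %% p) = win n (per_letter (cat g)) s by [].
apply/eqP/win_eqP => t tn; rewrite /per_letter !size_tuple.
have sE := divn_eq s p; have sjp := ltn_ord s.
rewrite nth_cat ?ltn_mod //.
have [lt|ge] := ltnP (s %% p + t) p.
  have stE : (s + t = s %/ p * p + (s %% p + t))%N by rewrite {1}sE addnA.
  have st : (s + t < j.+1 * p)%N by rewrite stE -qE; have := ltn_ord q; nia.
  by rewrite (modn_small st) stE divnMDl // (divn_small lt) addn0 modnMDl -/q.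
have lt2 : (s %% p + t - p < p)%N by lia.
have stE : (s + t = (s %/ p).+1 * p + (s %% p + t - p))%N.
  move: sE ge; set q' := (s %/ p)%N; set r := (s %% p)%N; clearbody q' r.
  by rewrite [(q'.+1 * p)%N]mulSn; lia.
have e1 : ((s %% p + t) %% p = s %% p + t - p)%N.
  by rewrite -{1}(subnK ge) modnDr modn_small.
(* After the last block the reading wraps to block 0. Which block comes next is irrelevant, thanks
   to the common prefix. *)
rewrite e1; have [q' ->] : exists q' : 'I_j.+1, ((s + t) %% (j.+1 * p) =
    q' * p + (s %% p + t - p))%N.
  have [qj|qj] := ltnP (s %/ p).+1 j.+1.
    exists (Ordinal qj); rewrite stE modn_small //=.
    apply: (@leq_trans ((s %/ p).+2 * p)%N); last by rewrite leq_mul2r qj orbT.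
    by rewrite [leqRHS]mulSn addnC ltn_add2r.
  exists ord0; rewrite stE; have -> : (s %/ p).+1 = j.+1.
    by apply/eqP; rewrite eqn_leq qj blk.
  by rewrite modnDl modn_small //=; apply: (leq_trans lt2); rewrite leq_pmull.
rewrite divnMDl // (divn_small lt2) addn0 modnMDl (modn_small lt2) inord_val.
by apply: agree; rewrite ?gG //; lia.
Qed.


Lemma prefix_pigeonhole n p (S : {set p.-tuple A}) : exists G : {set p.-tuple A},
  [/\ G \subset S,
    {in G &, forall y z : p.-tuple A, forall i, (i < n)%N -> nth a y i = nth a z i} &
    (#|S| <= #|A| ^ n * #|G|)%N].
Proof.
pose f (y : p.-tuple A) := win n (nth a y) 0.
pose F v := [set y in S | f y == v].
(* [v] is the most frequent prefix; the constant word only shows that prefixes exist. *)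
have [v _ vmax] := @arg_maxnP _ (nseq_tuple n a) predT (fun v => #|F v|) isT.
exists (F v); split.
- by apply/fintype.subsetP => y; rewrite inE => /andP[].
- move=> y z; rewrite !inE => /andP[_ /eqP yv] /andP[_ /eqP zv] i iN.
  have /eqP/win_eqP : f y = f z by rewrite yv zv.
  exact.
- rewrite -card_tuple -sum1_card (partition_big f predT) //=.
  rewrite -sum_nat_const; apply: leq_sum => w _.
  apply: leq_trans (vmax w isT).
  by rewrite sum1_card; apply: subset_leq_card; apply/fintype.subsetP => y; rewrite !inE.
Qed.

(** Since the windows at [c] and [d] agree, reading the loop cyclically past its end gives the
    letters of [u] after [d]; so each cyclic window of length [N] is a window of [u]. *)
Lemma loop_periodic X N M (u : M.-tuple A) c d :
    (N <= d - c)%N -> (0 < d - c)%N -> (d + N <= M)%N ->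
    windowed X (language X N) -> u \in language X M ->
    win N (nth a u) c = win N (nth a u) d ->
  win (d - c) (nth a u) c \in per_words X (d - c).
Proof.
move=> Nl l0 dM wX uX e; rewrite (mem_per_words _ l0 wX); apply/forallP => s.
have sl := ltn_ord s.
suff -> : win N (per_letter (win (d - c) (nth a u) c)) s = win N (nth a u) (c + s).
  apply: language_win; last by rewrite -mem_language.
  by rewrite size_tuple; lia.
apply/eqP/win_eqP => t tN; rewrite /per_letter size_tuple.
rewrite nth_win ?ltn_mod // -addnA; have [lt|ge] := ltnP (s + t) (d - c).
  by rewrite modn_small.
rewrite -{1}(subnK ge) modnDr modn_small; last by lia.
move/eqP/win_eqP : e => ->; last by lia.
by congr nth; lia.
Qed.

Lemma card_loops X N M c d :
    (N <= d - c)%N -> (0 < d - c)%N -> (d + N <= M)%N ->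
    windowed X (language X N) ->
  (#|[set u in language X M | win N (nth a u) c == win N (nth a u) d]| <=
   #|language X c| * #|per_words X (d - c)| * #|language X (M - d)|)%N.
Proof.
move=> Nl l0 dM wX.
pose cut (u : M.-tuple A) := (win c (nth a u) 0, win (d - c) (nth a u) c,
                              win (M - d) (nth a u) d).
have cut_inj : injective cut.
  move=> w w' [/eqP/win_eqP e1 /eqP/win_eqP e2 /eqP/win_eqP e3].
  apply: (@tuple_nth_inj _ a) => j jM; have [jc|cj] := ltnP j c; first exact: e1.
  have [jd|dj] := ltnP j d; first by rewrite -(subnKC cj); apply: e2; lia.
  by rewrite -(subnKC dj); apply: e3; lia.
rewrite -!cardsX -(card_imset _ cut_inj); apply: subset_leq_card.
apply/fintype.subsetP => _ /imsetP[u uL ->]; move: uL; rewrite inE => /andP[uX /eqP e].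
have uX' : in_language X u by rewrite -mem_language.
rewrite !finset.in_setX /= (loop_periodic Nl l0 dM wX uX e).
by rewrite !language_win ?size_tuple //; lia.
Qed.

(** Among [Q.+1] windows at multiples of [m] two coincide, so few sets of words with a loop cover
    the language of length [M]. A large one forces many periodic words of its loop length [l], and
    concatenation reaches all multiples of [l]. *)
Lemma periodic_growth (R : realType) X N (h delta : R) :
    windowed X (language X N) -> X !=set0 -> entropy R X = h%:E -> 0 < delta ->
  exists2 l, (0 < l)%N & forall j,
    expR ((h - delta) * (j.+1 * l)%:R) <= #|per_words X (j.+1 * l)|%:R.
Proof.
move=> wX X0 eX d0.
have [h' [eh' h0 lo hi]] := entropy_nonempty R X0.
have hh : h' = h by move: eh'; rewrite eX => -[].
rewrite hh in h0 lo hi.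
pose Q := (#|A| ^ N)%N.
have A0 : (0 < #|A|)%N by apply/card_gt0P; exists a.
have Q0 : (0 < Q)%N by rewrite expn_gt0 A0.
have Qr0 : 0 < Q%:R :> R by rewrite ltr0n.
(* The outer pieces may have total length near [Q * m] while the loop is as short as [m], hence the
   division by [Q]. *)
pose delta' := delta / (2 * Q%:R).
have dp0 : 0 < delta' by rewrite divr_gt0 // mulr_gt0.
have [K K0 hK] := hi _ dp0.
(* The factors account for the pairs of windows, the two outer pieces and the common prefix. *)
pose c := Q.+1%:R ^+ 2 * K ^+ 2 * Q%:R.
have c0 : 0 < c by rewrite !mulr_gt0 ?exprn_gt0.
pose m := (N + Num.bound `|2 / delta * (ln c + delta' * N%:R)|).+1.
have mN : (N <= m)%N by rewrite /m; lia.
have m_large : delta' * N%:R + ln c <= delta / 2 * m%:R.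
  have : 2 / delta * (ln c + delta' * N%:R) <= m%:R.
    apply: (le_trans (ler_norm _)); apply: (le_trans (ltW (archi_boundP (normr_ge0 _)))).
    by rewrite ler_nat /m leqW // leq_addl.
  rewrite -(ler_pM2l (x := delta / 2)) ?divr_gt0 //.
  by rewrite mulrA mulf_div [2 * delta]mulrC divff ?mul1r 1?addrC // gt_eqF // mulr_gt0.
pose M := (Q * m + N)%N.
pose L (k : 'I_Q.+1 * 'I_Q.+1) := [set u in language X M |
  win N (nth a u) (k.1 * m) == win N (nth a u) (k.2 * m)].
have cover : (#|language X M| <= \sum_(k : 'I_Q.+1 * 'I_Q.+1 | (k.1 < k.2)%N) #|L k|)%N.
  apply: (@leq_trans #|\bigcup_(k : 'I_Q.+1 * 'I_Q.+1 | (k.1 < k.2)%N) L k|%SET); last first.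
    elim/big_rec2 : _ => [|k n S _ IH]; first by rewrite cards0.
    by apply: (leq_trans (leq_card_setU _ _).1); rewrite leq_add2l.
  apply: subset_leq_card; apply/fintype.subsetP => u uX.
  pose w (k : 'I_Q.+1) := win N (nth a u) (k * m).
  have : ~~ injectiveb w.
    apply/negP => /injectiveP/leq_card; rewrite card_ord card_tuple.
    by rewrite ltnn.
  case/injectivePn => k [k' kk' e].
  apply/bigcupP; case: (ltngtP k k') => // [lt|gt|/val_inj e'].
  - by exists (k, k') => //; rewrite inE uX; apply/eqP.
  - by exists (k', k) => //; rewrite inE uX; apply/eqP.
  - by rewrite e' eqxx in kk'.
have [k kk hk] : exists2 k : 'I_Q.+1 * 'I_Q.+1, (k.1 < k.2)%N &
    (#|language X M| <= Q.+1 ^ 2 * #|L k|)%N.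
  apply: contrapT => H.
  have small (k : 'I_Q.+1 * 'I_Q.+1) : (k.1 < k.2)%N ->
      (Q.+1 ^ 2 * #|L k| < #|language X M|)%N.
    by move=> kk; rewrite ltnNge; apply/negP => ?; apply: H; exists k.
  have lpos := card_language_gt0 M X0.
  have : (Q.+1 ^ 2 * \sum_(k : 'I_Q.+1 * 'I_Q.+1 | (k.1 < k.2)%N) #|L k| <=
          Q.+1 ^ 2 * (#|language X M|).-1)%N.
    rewrite big_distrr /=.
    apply: (@leq_trans (\sum_(k : 'I_Q.+1 * 'I_Q.+1 | (k.1 < k.2)%N) #|language X M|.-1)).
      by apply: leq_sum => k /small lt; rewrite -ltnS prednK.
    rewrite sum_nat_const leq_mul2r; apply/orP; right.
    by rewrite (leq_trans (max_card _)) // card_prod card_ord mulnn.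
  by rewrite leq_pmul2l ?expn_gt0 // leqNgt (leq_trans _ cover) // prednK.
have kQ : (k.2 <= Q)%N by rewrite -ltnS.
pose l := (k.2 * m - k.1 * m)%N.
have lE : l = ((k.2 - k.1) * m)%N by rewrite /l mulnBl.
have lm : (m <= l)%N by rewrite lE leq_pmull // subn_gt0.
have l0 : (0 < l)%N by apply: leq_trans lm.
exists l => //.
have dM : (k.2 * m + N <= M)%N by rewrite /M leq_add2r leq_mul2r kQ orbT.
have cnt := card_loops (leq_trans mN lm) l0 dM wX.
rewrite -/(L k) -/l in cnt.
(* The factor [Q] is spent below on fixing a common prefix of length [N]. *)
have Pl : Q%:R * expR ((h - delta) * l%:R) <= #|per_words X l|%:R.
  have K20 : 0 < K ^+ 2 * expR ((h + delta') * (k.1 * m + (M - k.2 * m))%:R).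
    by rewrite mulr_gt0 ?exprn_gt0 ?expR_gt0.
  have up : expR (h * M%:R) <= Q.+1%:R ^+ 2 * (#|per_words X l|%:R *
      (K ^+ 2 * expR ((h + delta') * (k.1 * m + (M - k.2 * m))%:R))).
    apply: (le_trans (lo M)).
    apply: (@le_trans _ _ (Q.+1 ^ 2 * #|L k|)%:R); first by rewrite ler_nat.
    rewrite natrM natrX ler_wpM2l ?exprn_ge0 //.
    have cntR : #|L k|%:R <= #|language X (k.1 * m)|%:R * #|per_words X l|%:R *
        #|language X (M - k.2 * m)|%:R :> R by rewrite -!natrM ler_nat.
    apply: (le_trans cntR); rewrite mulrAC mulrC ler_wpM2l //.
    apply: (le_trans (ler_pM _ _ (hK _) (hK _))) => //.
    by rewrite mulrACA -expr2 -expRD -mulrDr -natrD.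
  have e1 : expR (h * M%:R) / (Q.+1%:R ^+ 2 * (K ^+ 2 *
      expR ((h + delta') * (k.1 * m + (M - k.2 * m))%:R))) <= #|per_words X l|%:R.
    rewrite ler_pdivrMr; last by apply: mulr_gt0 K20; rewrite exprn_gt0.
    by rewrite mulrCA; exact: up.
  apply: le_trans e1.
  rewrite ler_pdivlMr; last by apply: mulr_gt0 K20; rewrite exprn_gt0.
  have -> : Q%:R * expR ((h - delta) * l%:R) * (Q.+1%:R ^+ 2 * (K ^+ 2 *
      expR ((h + delta') * (k.1 * m + (M - k.2 * m))%:R))) =
    expR (ln c + ((h - delta) * l%:R + (h + delta') * (k.1 * m + (M - k.2 * m))%:R)).
    by rewrite !expRD lnK ?posrE // /c; ring.
  rewrite ler_expR.
  have ME : (k.1 * m + (M - k.2 * m) + l = M)%N by rewrite /l; nia.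
  have MEr : (k.1 * m + (M - k.2 * m))%:R + l%:R = M%:R :> R by rewrite -natrD ME.
  have sM : (k.1 * m + (M - k.2 * m))%:R <= (Q * m + N)%:R :> R.
    by rewrite ler_nat -/M -[leqRHS]ME leq_addr.
  have lmR : m%:R <= l%:R :> R by rewrite ler_nat.
  have dq : delta' * (Q * m + N)%:R = delta / 2 * m%:R + delta' * N%:R.
    by rewrite natrD natrM mulrDr mulrA /delta'; congr (_ + _); field; rewrite gt_eqF.
  have : delta' * (k.1 * m + (M - k.2 * m))%:R <= delta' * (Q * m + N)%:R.
    by rewrite ler_wpM2l // ltW.
  have : delta * m%:R <= delta * l%:R by rewrite ler_wpM2l // ltW.
  rewrite -MEr; nra.
have [G [GX agree hG]] := prefix_pigeonhole N (per_words X l).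
move=> j; apply: (@le_trans _ _ (#|G| ^ j.+1)%:R); last first.
  by rewrite ler_nat; apply: (card_concat _ _ _ wX) => //; exact: leq_trans lm.
rewrite natrM mulrCA mulrC natrX mulrC expRM_natl ler_pXn2r ?nnegrE ?expR_ge0 //.
rewrite -(ler_pM2l Qr0); apply: (le_trans Pl).
by rewrite -natrM ler_nat.
Qed.

Lemma entropy_ge_per_words (R : realType) Z n (O : {set n.-tuple A}) p (g : R) :
    (0 < p)%N -> (n <= p)%N -> windowed Z O ->
    (#|A| ^ n)%:R * expR (g * p%:R) <= #|per_words Z p|%:R ->
  (g%:E <= entropy R Z)%E.
Proof.
move=> p0 np wZ hg; apply: (entropy_ge p0) => j.
have A0 : 0 < (#|A| ^ n)%:R :> R.
  by rewrite ltr0n expn_gt0; apply/orP; left; apply/card_gt0P; exists a.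
have [G [GX agree hG]] := prefix_pigeonhole n (per_words Z p).
apply: (@le_trans _ _ (#|G| ^ j.+1)%:R); last first.
  rewrite ler_nat; apply: (leq_trans (card_concat _ p0 np wZ GX agree)).
  by apply/subset_leq_card/per_words_sub_language; rewrite muln_gt0.
rewrite natrM mulrCA mulrC natrX mulrC expRM_natl ler_pXn2r ?nnegrE ?expR_ge0 //.
rewrite -(ler_pM2l A0); apply: (le_trans hg).
by rewrite -natrM ler_nat.
Qed.

End Periodic.

(** * First and second moments *)

Section Bounds.
Variables (R : realType) (A : finType) (a : A) (X : set (int -> A)).
Variables (alpha : R) (n : nat).
Hypotheses (alpha_ge0 : 0 <= alpha) (alpha_le1 : alpha <= 1) (n_gt0 : (0 < n)%N).

(** The weight of one cell: every possible cell word, each letter standing for a new window. *)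
Definition language_weight : R :=
  \sum_(w : n.-bseq A | in_language X w) alpha ^+ size w.

(** Bounds the number of codes of a cell when [p <= C * n] and [#|D| <= d]; polynomial in [n] if [d]
    is. *)
Definition code_bound (C d : nat) : R := (((n * (d + C * n)) ^ 2).+1)%:R.

Lemma language_weight_ge0 : 0 <= language_weight.
Proof. by apply: sumr_ge0 => w _; rewrite exprn_ge0. Qed.

(** The longest words dominate, since each extra letter multiplies the bound by [alpha * expR g],
    which is at least 1. *)
Lemma language_weight_le (K g : R) : 0 <= K ->
    (forall l, #|language X l|%:R <= K * expR (g * l%:R)) -> 1 <= alpha * expR g ->
  language_weight <= n.+1%:R * (K * (alpha * expR g) ^+ n).
Proof.
move=> K0 hK g1.
rewrite /language_weight (partition_big (fun w : n.-bseq A => inord (size w) : 'I_n.+1) predT) //=.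
have -> : n.+1%:R * (K * (alpha * expR g) ^+ n) =
    \sum_(l < n.+1) (K * (alpha * expR g) ^+ n).
  by rewrite sumr_const card_ord mulr_natl.
apply: ler_sum => l _.
have szE (w : n.-bseq A) : (inord (size w) : 'I_n.+1) = l -> size w = l.
  by move=> <-; rewrite inordK // ltnS size_bseq.
apply: (@le_trans _ _ (\sum_(w : n.-bseq A |
    in_language X w && (inord (size w) == l)) alpha ^+ l)).
  by apply: ler_sum => w /andP[_ /eqP /szE ->].
rewrite sumr_const.
apply: (@le_trans _ _ (alpha ^+ l *+ #|language X l|)).
  apply: ler_wpMn2l; first by rewrite exprn_ge0.
  rewrite -(card_in_imset (f := fun w : n.-bseq A => win l (nth a w) 0)); last first.
    move=> w w'; rewrite !unfold_in => /andP[_ /eqP/szE sw] /andP[_ /eqP/szE sw'] /eqP/win_eqP e.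
    apply: val_inj; apply: (@eq_from_nth _ a); first by rewrite sw sw'.
    by move=> i; rewrite sw => il; exact: e.
  apply: subset_leq_card; apply/fintype.subsetP => _ /imsetP[w wl ->].
  move: wl; rewrite unfold_in => /andP[wX /eqP/szE sw].
  by apply: language_win; rewrite ?sw.
rewrite -mulr_natr.
apply: (@le_trans _ _ (alpha ^+ l * (K * expR (g * l%:R)))).
  by rewrite ler_wpM2l // exprn_ge0.
rewrite mulrCA ler_wpM2l // mulrC expRM_natr mulrC -exprMn.
by rewrite ler_weXn2l // -ltnS ltn_ord.
Qed.

Lemma code_bound_le C d d' : (d <= d')%N -> code_bound C d <= code_bound C d'.
Proof.
by move=> dd; rewrite ler_nat ltnS leq_exp2r // leq_mul2l leq_add2r dd orbT.
Qed.

Lemma cell_word_in_language p (D : {set n.-tuple A}) (f : nat -> A) (u : seq A) J :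
    (p <= size u)%N -> (forall i, (i < p)%N -> f i = nth a u i) -> in_language X u ->
  in_language X (cell_word p D f J).
Proof.
move=> pu fu uX; have [b [m [-> bm]]] := cell_word_subword p D f J.
have [b' bm' e] : exists2 b', (b' + m <= p)%N & iota b m = iota b' m.
  by case: bm => [|->]; [exists b|exists 0%N; rewrite ?addn0].
have -> : [seq f i | i <- iota b m] = win m (nth a u) b'.
  rewrite e val_win; apply/eq_in_map => i; rewrite mem_iota => ibm.
  by apply: fu; lia.
by rewrite -mem_language language_win //; lia.
Qed.

(** Decoding recovers only the positions below [C * n]; the last [n] letters are fixed beforehand,
    at the price [#|A| ^ n]. *)
Lemma word_weight_sum C :
  \sum_(u in language X (C * n + n))
     alpha ^+ #|[set win n (nth a u) (val s) | s : 'I_(C * n)]| <=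
  (#|A| ^ n)%:R * (code_bound C 0 * language_weight) ^+ C.
Proof.
rewrite (partition_big (fun u : (C * n + n).-tuple A => win n (nth a u) (C * n)) predT) //=.
rewrite -card_tuple mulr_natl -sumr_const; apply: ler_sum => z _.
pose Y := [set u in language X (C * n + n) | win n (nth a u) (C * n) == z].
have := @weighted_count R A _ n (C * n) C finset.set0 (fun u : (C * n + n).-tuple A => nth a u)
  Y (fun=> in_language X) alpha n_gt0 (leqnn _).
rewrite alpha_ge0 alpha_le1 cards0 => /(_ isT) h.
rewrite (eq_bigl [in Y]); last by move=> u; rewrite !inE.
under eq_bigr do rewrite -[X in #|pred_of_set X|]finset.setD0.
apply: le_trans (h _ _) _.
- move=> u v; rewrite !inE => /andP[_ /eqP uz] /andP[_ /eqP vz] e.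
  apply: (@tuple_nth_inj _ a) => j jM; have [jp|pj] := ltnP j (C * n); first exact: e.
  move: uz; rewrite -vz => /eqP/win_eqP /(_ (j - C * n)%N); rewrite subnKC //; apply; lia.
- move=> u; rewrite inE mem_language => /andP[uX _] J.
  by apply: (cell_word_in_language _ _ _ _ uX) => //; rewrite size_tuple leq_addr.
- by rewrite prodr_const card_ord.
Qed.

(** Markov's inequality for the number of words of [X] whose windows at starts below [C * n]
    survive; ignoring the last window can only increase this number. *)
Lemma prob_language_ge C (t : R) : 0 < t ->
  prob (language X n) alpha
    [set omega | t <= #|language (sub_SFT X omega) (C * n + n)|%:R] <=
  (#|A| ^ n)%:R * (code_bound C 0 * language_weight) ^+ C / t.
Proof.
move=> t0; pose W (u : (C * n + n).-tuple A) := [set win n (nth a u) (val s) | s : 'I_(C * n)].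
have Wlang u : u \in language X (C * n + n) -> W u \subset language X n.
  rewrite mem_language => uX; apply/fintype.subsetP => _ /imsetP[s _ ->].
  by apply: language_win => //; rewrite size_tuple leq_add2r; exact: ltnW (ltn_ord s).
pose f (omega : {set n.-tuple A}) : R :=
  \sum_(u in language X (C * n + n)) (W u \subset omega)%:R.
apply: (le_trans (@markov_subset R _ (language X n) alpha alpha_ge0 alpha_le1 _ f t t0 _ _)).
- by move=> o; apply: sumr_ge0.
- move=> o oX /= h; apply: (le_trans h).
  rewrite /f -natr_sum ler_nat -sum1_card big_mkcond [leqRHS]big_mkcond /=.
  apply: leq_sum => u _; case: ifP => // uo.
  have [x [Xx xo] ux] : exists2 x, sub_SFT X o x & appears u x.
    by move: uo; rewrite mem_language => /asboolP.
  have -> : u \in language X (C * n + n).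
    by rewrite mem_language; apply/asboolP; exists x.
  suff -> : W u \subset o by [].
  apply/fintype.subsetP => _ /imsetP[s _ ->]; apply: xo.
  by apply: appears_win ux; rewrite size_tuple leq_add2r; exact: ltnW (ltn_ord s).
- rewrite ler_wpM2r ?invr_ge0 ?(ltW t0) // /f mean_sum.
  apply: le_trans (word_weight_sum C); apply: ler_sum => u uX.
  by rewrite mean_superset ?Wlang.
Qed.


(** * Rotations and pairs of periodic words sharing a window *)

Definition rotate_word p (j : nat) (y : p.-tuple A) : p.-tuple A :=
  win p (per_letter a y) j.

Lemma per_letter_rotate p j (y : p.-tuple A) i : (0 < p)%N ->
  per_letter a (rotate_word j y) i = per_letter a y (j + i).
Proof.
move=> p0; rewrite {1}/per_letter size_tuple nth_win ?ltn_mod //.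
by rewrite /per_letter size_tuple modnDmr.
Qed.

Lemma rotate_word_inj p j : (0 < p)%N -> injective (@rotate_word p j).
Proof.
move=> p0 y z e; apply: (@tuple_nth_inj _ a) => i ip.
(* Moving on by [j * p.-1] undoes the rotation, as the total shift [j * p] is a multiple of the
   period. *)
have key (u : p.-tuple A) : nth a u i = per_letter a (rotate_word j u) (i + j * p.-1).
  rewrite per_letter_rotate // /per_letter size_tuple.
  by rewrite addnCA -{1}(muln1 j) -mulnDr add1n prednK // addnC modnMDl modn_small.
by rewrite !key e.
Qed.

Lemma per_windows_rotate p j (y : p.-tuple A) : (0 < p)%N ->
  per_windows a n (rotate_word j y) = per_windows a n y.
Proof.
move=> p0; have winE (s s' : nat) : (j + s = s' %[mod p])%N ->
    win n (per_letter a (rotate_word j y)) s = win n (per_letter a y) s'.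
  move=> e; apply/eqP/win_eqP => t _; rewrite per_letter_rotate // addnA.
  by rewrite /per_letter size_tuple -modnDml e modnDml.
apply/setP => w; apply/imsetP/imsetP => -[s _ ->].
  exists (Ordinal (ltn_pmod (j + s) p0)) => //; apply: winE.
  by rewrite /= modn_mod.
exists (Ordinal (ltn_pmod (s + j * p.-1) p0)) => //; symmetry; apply: winE.
by rewrite /= modnDmr addnCA -{1}(muln1 j) -mulnDr add1n prednK // addnC modnMDl.
Qed.

(** The window at 0 lies in [D] and covers the first cell, whose cell word is therefore empty. This
    cell contributes only its code, so the power of [language_weight] drops from [C.+1] to [C]: the
    gain on which the second moment rests. *)
Lemma rotated_weight_sum C p (D : {set n.-tuple A}) :
    windowed X (language X n) -> (0 < p)%N -> (p <= C.+1 * n)%N -> (#|D| <= C.+1 * n)%N ->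
  \sum_(y in per_words a X p | win n (per_letter a y) 0 \in D)
     alpha ^+ #|per_windows a n y :\: D| <=
  code_bound C.+1 (C.+1 * n) ^+ C.+1 * language_weight ^+ C.
Proof.
move=> wX p0 pC DC.
pose Y := [set y in per_words a X p | win n (per_letter a y) 0 \in D].
have := @weighted_count R A _ n p C.+1 D (fun y : p.-tuple A => per_letter a y)
  Y (fun J w => in_language X w && ((J == ord0) ==> nilp w)) alpha n_gt0 pC.
rewrite alpha_ge0 alpha_le1 => /(_ isT) h.
rewrite (eq_bigl [in Y]); last by move=> u; rewrite !inE.
apply: le_trans (h _ _) _.
- move=> u v _ _ e; apply: (@tuple_nth_inj _ a) => i ip.
  by have := e i ip; rewrite /per_letter !size_tuple modn_small.
- move=> y; rewrite inE => /andP[yX yD] J; apply/andP; split.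
    have yl := fintype.subsetP (per_words_sub_language a X p0) _ yX.
    rewrite mem_language in yl.
    apply: (cell_word_in_language _ _ _ _ yl); first by rewrite size_tuple.
    by move=> i ip; rewrite /per_letter size_tuple modn_small.
  apply/implyP => /eqP ->; rewrite /nilp size_map size_filter.
  rewrite -leqn0 leqNgt -has_count; apply/hasPn => i.
  rewrite mem_iota /= => iN; rewrite negb_and; apply/orP; right.
  apply/not_freeP; exists 0%N; split=> //; by rewrite /repeated yD.
have Q0 : 0 <= code_bound C.+1 (C.+1 * n) by rewrite ler0n.
have QD : (((n * (#|D| + p)) ^ 2).+1)%:R <= code_bound C.+1 (C.+1 * n).
  by rewrite ler_nat ltnS leq_exp2r // leq_mul2l leq_add ?orbT.
rewrite big_ord_recl /= exprS -[leRHS]mulrA; apply: ler_pM => //.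
- by apply: mulr_ge0 => //; apply: sumr_ge0 => w _; rewrite exprn_ge0.
- apply: prodr_ge0 => J _; apply: mulr_ge0 => //.
  by apply: sumr_ge0 => w _; rewrite exprn_ge0.
- rewrite -[leRHS]mulr1; apply: ler_pM => //.
    by apply: sumr_ge0 => w _; rewrite exprn_ge0.
  apply: (@le_trans _ _ (\sum_(w : n.-bseq A | w == [bseq]) 1)); last first.
    by rewrite big_pred1_eq.
  rewrite [leLHS]big_mkcond [leRHS]big_mkcond; apply: ler_sum => w _ /=.
  case: ifP => [/andP[_ wn]|_]; last by case: ifP.
  have -> : w == [bseq] by rewrite -val_eqE /= -nilpE.
  by rewrite (nilP wn) expr0.
- rewrite -exprMn -[X in _ ^+ X]card_ord -prodr_const; apply: ler_prod => J _.
  have S0 : 0 <= \sum_(w : n.-bseq A | in_language X w && ((lift ord0 J == ord0) ==> nilp w))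
      alpha ^+ size w by apply: sumr_ge0 => w _; rewrite exprn_ge0.
  apply/andP; split; first by apply: mulr_ge0.
  apply: ler_pM => //; rewrite le_eqVlt; apply/orP; left; apply/eqP.
  by apply: eq_bigl => w; rewrite andbT.
Qed.

(** Union bound over the start [j] in [y] of a shared window. Rotating by [j] moves it to 0,
    permutes the periodic words and preserves their sets of windows. *)
Lemma meeting_weight_sum C p (x : p.-tuple A) :
    windowed X (language X n) -> (0 < p)%N -> (p <= C.+1 * n)%N ->
  \sum_(y in per_words a X p | ~~ [disjoint per_windows a n x & per_windows a n y])
     alpha ^+ #|per_windows a n y :\: per_windows a n x| <=
  p%:R * (code_bound C.+1 (C.+1 * n) ^+ C.+1 * language_weight ^+ C).
Proof.
move=> wX p0 pC; set D := per_windows a n x.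
pose wt (y : p.-tuple A) := alpha ^+ #|per_windows a n y :\: D|.
have DC : (#|D| <= C.+1 * n)%N.
  by apply: leq_trans pC; rewrite (leq_trans (leq_imset_card _ _)) // card_ord.
apply: (@le_trans _ _ (\sum_(j < p) \sum_(y in per_words a X p |
    win n (per_letter a y) j \in D) wt y)).
  rewrite [leLHS]big_mkcondr /= (exchange_big_dep [in per_words a X p]) /=; last first.
    by move=> j y _ /andP[].
  apply: ler_sum => y yX; case: ifPn => [|_]; last by apply: sumr_ge0 => j _; rewrite exprn_ge0.
  rewrite -setI_eq0 => /set0Pn[w]; rewrite inE => /andP[wD /imsetP[j _ wE]].
  rewrite (bigD1 j) /=; last by rewrite yX -wE.
  by rewrite lerDl sumr_ge0 // => k _; rewrite exprn_ge0.
rewrite -[X in X%:R]card_ord mulr_natl -sumr_const; apply: ler_sum => j _.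
apply: le_trans (rotated_weight_sum wX p0 pC DC).
have rX (y : p.-tuple A) : (rotate_word j y \in per_words a X p) = (y \in per_words a X p).
  by rewrite !(per_words_windows _ _ p0 wX) per_windows_rotate.
rewrite [leRHS](reindex_inj (rotate_word_inj (j := j) p0)) /=.
rewrite le_eqVlt; apply/orP; left; apply/eqP; apply: eq_big => y.
  rewrite rX; suff -> : win n (per_letter a (rotate_word j y)) 0 = win n (per_letter a y) j by [].
  by apply/eqP/win_eqP => t _; rewrite per_letter_rotate.
by move=> _; rewrite /wt per_windows_rotate.
Qed.

Lemma prob_few_periodic C p :
    windowed X (language X n) -> 0 < alpha -> (0 < p)%N -> (p <= C.+1 * n)%N ->
    (0 < #|per_words a X p|)%N ->
  prob (language X n) alpha [set omega |
    #|per_words a (sub_SFT X omega) p|%:R <= #|per_words a X p|%:R * alpha ^+ p / 2] <=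
  4 * (p%:R * (code_bound C.+1 (C.+1 * n) ^+ C.+1 * language_weight ^+ C)) /
    (#|per_words a X p|%:R * alpha ^+ p).
Proof.
move=> wX alpha0 p0 pC Y0.
pose Y := per_words a X p.
(* A word may have fewer than [p] distinct windows; a lower bound on the mean is enough, since the
   mean is a denominator. *)
have tau_ge : #|Y|%:R * alpha ^+ p <= \sum_(y in Y) alpha ^+ #|per_windows a n y|.
  rewrite mulr_natl -sumr_const; apply: ler_sum => y _; apply: ler_wiXn2l => //.
  by rewrite (leq_trans (leq_imset_card _ _)) // card_ord.
have Ya0 : 0 < #|Y|%:R * alpha ^+ p by rewrite mulr_gt0 ?ltr0n // exprn_gt0.
have tau0 := lt_le_trans Ya0 tau_ge.
have WY : {in Y, forall y, per_windows a n y \subset language X n}.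
  by move=> y yY; rewrite -(per_words_windows _ _ p0 wX).
have meet : {in Y, forall x, \sum_(y in Y | ~~ [disjoint per_windows a n x & per_windows a n y])
    alpha ^+ #|per_windows a n y :\: per_windows a n x| <=
    p%:R * (code_bound C.+1 (C.+1 * n) ^+ C.+1 * language_weight ^+ C)}.
  by move=> x _; exact: meeting_weight_sum.
apply: (le_trans (second_moment alpha_ge0 alpha_le1 WY meet tau0 _)).
- move=> o oX /= h; apply: (@le_trans _ _ (#|Y|%:R * alpha ^+ p / 2)).
    apply: le_trans h; rewrite ler_nat; apply: subset_leq_card.
    apply/fintype.subsetP => y; rewrite inE => /andP[_ yo].
    by rewrite (per_words_windows _ _ p0 (sub_SFT_windowed wX oX)).
  by rewrite ler_pM2r ?invr_gt0.
- rewrite ler_wpM2l ?lef_pV2 ?posrE //.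
  by rewrite mulr_ge0 // mulr_ge0 // mulr_ge0 // exprn_ge0 ?language_weight_ge0.
Qed.

End Bounds.

(** * Exponential tails *)

Lemma natX_le_expR (R : realType) (k : nat) (delta : R) : 0 < delta ->
  exists2 K : R, 0 < K & forall n, n.+1%:R ^+ k <= K * expR (delta * n%:R).
Proof.
(* [1 + x <= expR x] bounds [n.+1] by [c * expR (n.+1 / c)], whose power [k] has rate [k / c], less
   than [delta]; [k.+1] keeps [c] positive when [k = 0]. *)
move=> d0; pose c := k.+1%:R / delta.
have c0 : 0 < c by rewrite divr_gt0.
exists (c ^+ k * expR delta); first by rewrite mulr_gt0 ?exprn_gt0 ?expR_gt0.
move=> n; apply: (@le_trans _ _ ((c * expR (n.+1%:R / c)) ^+ k)).
  have ce0 : 0 <= c * expR (n.+1%:R / c) by apply: mulr_ge0; [exact: ltW|exact: expR_ge0].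
  apply: lerXn2r; rewrite ?nnegrE //.
  have := expR_ge1Dx (n.+1%:R / c) => h.
  apply: (@le_trans _ _ (c * (1 + n.+1%:R / c))); last by rewrite ler_pM2l.
  by rewrite mulrDr mulr1 mulrCA divff ?gt_eqF // mulr1 lerDr ltW.
rewrite exprMn -expRM_natl -mulrA ler_wpM2l ?exprn_ge0 ?(ltW c0) // -expRD ler_expR.
have -> : k%:R * (n.+1%:R / c) = delta * n.+1%:R * (k%:R / k.+1%:R).
  by rewrite /c invf_div; ring.
have : k%:R / k.+1%:R <= 1 :> R by rewrite ler_pdivrMr // mul1r ler_nat.
move=> h; apply: (@le_trans _ _ (delta * n.+1%:R * 1)).
  by rewrite ler_wpM2l // mulr_ge0 // ltW.
by rewrite mulr1 -natr1; lra.
Qed.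

Lemma code_bound_le_expR (R : realType) (C : nat) (delta : R) : 0 < delta ->
  exists2 K : R, 1 <= K & forall n,
    [/\ code_bound R n C (C * n) * n.+1%:R <= K * expR (delta * n%:R),
        n%:R <= K * expR (delta * n%:R) & 1 <= K * expR (delta * n%:R)].
Proof.
(* The code bound has degree 4 in [n], and the factor [n.+1] adds one. *)
move=> d0; have [K K0 hK] := natX_le_expR 5 d0.
pose c : R := ((2 * C) ^ 2).+1%:R.
have c1 : 1 <= c by rewrite ler1n.
have K1 : 1 <= K by have := hK 0%N; rewrite expr1n mulr0 expR0 mulr1.
exists (c * K) => [|n]; first by rewrite -[leLHS]mulr1 ler_pM.
have n5 : n.+1%:R <= c * K * expR (delta * n%:R).
  apply: (@le_trans _ _ (c * n.+1%:R ^+ 5)); last by rewrite -mulrA ler_wpM2l ?hK // (le_trans ler01).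
  rewrite -[leLHS]mul1r ler_pM // -[leLHS]expr1 ler_weXn2l //.
  by rewrite ler1n.
split.
- apply: (@le_trans _ _ (c * n.+1%:R ^+ 5)); last by rewrite -mulrA ler_wpM2l ?hK // (le_trans ler01).
  have -> : code_bound R n C (C * n) = ((2 * C * n ^ 2) ^ 2).+1%:R.
    by rewrite /code_bound; congr (_ ^ 2).+1%:R; lia.
  rewrite -natrX -!natrM ler_nat [(n.+1 ^ 5)%N]expnSr mulnA leq_mul2r.
  apply/orP; right; rewrite expnMn -expnM [(_ * n.+1 ^ 4)%N]mulSn -[leqLHS]addn1 [leqRHS]addnC.
  apply: leq_add; last by rewrite expn_gt0.
  by rewrite leq_mul2l leq_exp2r // leqnSn orbT.
- by apply: le_trans n5; rewrite ler_nat.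
- by apply: le_trans n5; rewrite ler1n.
Qed.

Section Tails.
Variables (R : realType) (A : finType) (a : A) (X : set (int -> A)).
Variables (alpha h eps delta : R) (C : nat).
Hypotheses (X_SFT : is_SFT X) (X0 : X !=set0) (X_entropy : entropy R X = h%:E).
Hypotheses (alpha_gt0 : 0 < alpha) (alpha_le1 : alpha <= 1).
Hypotheses (eps_gt0 : 0 < eps) (delta_gt0 : 0 < delta) (delta_eps : delta <= eps / 4).
(** The target entropy. Below, [C_eps] makes a factor [#|A| ^ n] negligible at length [C.+1 * n],
    and [C_delta] keeps the errors of all cells within half of the gain [th] of one cell. *)
Let th := ln alpha + h.
Hypotheses (th_gt0 : 0 < th) (C_gt0 : (0 < C)%N).
Hypotheses (C_eps : ln #|A|%:R + 1 <= C.+1%:R * (eps / 4)).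
Hypotheses (C_delta : 4 * C.+1%:R * delta <= th / 2).

Let A_gt0 : (0 < #|A|)%N.
Proof. by apply/card_gt0P; exists a. Qed.

Let expn_cardA n : (#|A| ^ n)%:R = expR (ln #|A|%:R * n%:R) :> R.
Proof. by rewrite expRM_natr lnK ?posrE ?ltr0n // natrX. Qed.

Let alphaX n : alpha ^+ n = expR (ln alpha * n%:R).
Proof. by rewrite expRM_natr lnK ?posrE. Qed.

(** In [th + 2 * delta], one [delta] pays for the upper bound on word counts, the other for
    polynomial factors. *)
Lemma weights_le : exists2 K : R, 1 <= K & forall n,
  [/\ code_bound R n C.+1 (C.+1 * n) * language_weight X alpha n <=
        K * expR ((th + 2 * delta) * n%:R),
      code_bound R n C.+1 (C.+1 * n) <= K * expR (delta * n%:R),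
      language_weight X alpha n <= K * expR ((th + 2 * delta) * n%:R) &
      n%:R <= K * expR (delta * n%:R)].
Proof.
have [h' [eh _ _ hub]] := entropy_nonempty R X0.
have hh : h' = h by move: eh; rewrite X_entropy => -[].
rewrite hh in hub; have [K K0 hK] := hub _ delta_gt0.
have K1 : 1 <= K.
  have := hK 0%N; rewrite mulr0 expR0 mulr1; apply: le_trans.
  by rewrite ler1n card_language_gt0.
have [K' K'1 hK'] := code_bound_le_expR C.+1 delta_gt0.
have KK : 1 <= K * K' by rewrite -[leLHS]mulr1 ler_pM.
have K'K : K' <= K * K' by rewrite -[leLHS]mul1r ler_wpM2r // (le_trans ler01).
have gE n : (alpha * expR (h + delta)) ^+ n = expR ((th + delta) * n%:R).
  by rewrite exprMn alphaX -expRM_natr -expRD /th; congr expR; ring.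
have g1 : 1 <= alpha * expR (h + delta).
  by have := gE 1%N; rewrite expr1 mulr1 => ->; rewrite -[leLHS]expR0 ler_expR addr_ge0 ?ltW.
exists (K * K') => // n; have [q1 q2 q3] := hK' n.
have code1 : 1 <= code_bound R n C.+1 (C.+1 * n) by rewrite ler1n.
have L0 : 0 <= language_weight X alpha n by apply: language_weight_ge0; exact: ltW.
have Lle := @language_weight_le R A a X alpha n (ltW alpha_gt0) K (h + delta) (ltW K0) hK g1.
have codeL : code_bound R n C.+1 (C.+1 * n) * language_weight X alpha n <=
    K * K' * expR ((th + 2 * delta) * n%:R).
  apply: (@le_trans _ _ (code_bound R n C.+1 (C.+1 * n) *
      (n.+1%:R * (K * (alpha * expR (h + delta)) ^+ n)))).
    by rewrite ler_wpM2l // (le_trans ler01).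
  rewrite gE mulrA; apply: (@le_trans _ _ (K' * expR (delta * n%:R) *
      (K * expR ((th + delta) * n%:R)))).
    by rewrite ler_wpM2r // mulr_ge0 ?expR_ge0 // ltW.
  rewrite mulrACA -expRD [K' * K]mulrC ler_wpM2l // ?(le_trans ler01) // ler_expR.
  by rewrite le_eqVlt; apply/orP; left; apply/eqP; ring.
have d0 : 0 <= expR (delta * n%:R) by exact: expR_ge0.
have e0 : K' * expR (delta * n%:R) <= K * K' * expR (delta * n%:R) by rewrite ler_wpM2r.
split=> //; last exact: le_trans e0.
- apply: le_trans e0; apply: le_trans q1; rewrite -[leLHS]mulr1 ler_wpM2l //.
  by rewrite ler1n.
- by apply: le_trans codeL; rewrite -[leLHS]mul1r ler_wpM2r.
Qed.

(** The lower bound on word counts is exact, so large entropy already shows at length [M], where the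
    first moment applies. *)
Lemma prob_large_entropy : exists2 K : R, 0 < K & forall n, (0 < n)%N ->
  prob (language X n) alpha
    [set omega | ((th + eps)%:E <= entropy R (sub_SFT X omega))%E] <=
  K * expR (- n%:R).
Proof.
have [K K1 hK] := weights_le.
exists (K ^+ C.+1); first by rewrite exprn_gt0 // (lt_le_trans ltr01).
move=> n n0; have [q1 _ _ _] := hK n.
have a0 := ltW alpha_gt0.
pose M := (C.+1 * n + n)%N.
pose t : R := expR ((th + eps) * M%:R).
have t0 : 0 < t by exact: expR_gt0.
apply: (@le_trans _ _ (prob (language X n) alpha
    [set omega | t <= #|language (sub_SFT X omega) M|%:R])).
  apply: prob_le => // o oX /= ho.
  have o0 : sub_SFT X o !=set0.
    by apply: contrapT => /entropy_empty e; move: ho; rewrite e leeNy_eq.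
  have [g [eg _ lo _]] := entropy_nonempty R o0.
  move: ho; rewrite eg lee_fin => ho; apply: le_trans (lo M).
  by rewrite ler_expR ler_wpM2r.
apply: (le_trans (prob_language_ge a X a0 alpha_le1 n0 C.+1 t0)).
rewrite expn_cardA ler_pdivrMr // -mulrA -expRD.
have c0 : code_bound R n C.+1 0 * language_weight X alpha n <= K * expR ((th + 2 * delta) * n%:R).
  apply: le_trans q1; rewrite ler_wpM2r ?language_weight_ge0 //.
  exact: code_bound_le.
apply: (@le_trans _ _ (expR (ln #|A|%:R * n%:R) *
    (K * expR ((th + 2 * delta) * n%:R)) ^+ C.+1)).
  rewrite ler_wpM2l ?expR_ge0 // lerXn2r ?nnegrE //.
    by rewrite mulr_ge0 ?language_weight_ge0.
  by rewrite mulr_ge0 ?expR_ge0 // (le_trans ler01).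
rewrite exprMn mulrCA ler_wpM2l ?exprn_ge0 ?(le_trans ler01) // -expRM_natl -expRD ler_expR.
rewrite /M natrD natrM.
have n0' : 0 <= n%:R :> R by [].
have h1 : (ln #|A|%:R + 1) * n%:R <= C.+1%:R * (eps / 4) * n%:R by rewrite ler_wpM2r.
have h2 : C.+1%:R * n%:R * delta <= C.+1%:R * n%:R * (eps / 4) by rewrite ler_wpM2l.
have h3 : 0 <= (th + eps) * n%:R by rewrite mulr_ge0 // addr_ge0 ?ltW.
have h4 : 0 <= C.+1%:R * n%:R * (eps / 4).
  by apply: mulr_ge0; [exact: mulr_ge0|rewrite divr_ge0 // ltW].
lra.
Qed.

(** The second moment gives about [expR (C * th * n)] over [expR (th * p)] with [p] close to
    [C.+1 * n]. Of the resulting rate [th], half is kept and half absorbs the errors. *)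
Lemma prob_small_entropy : exists2 K : R, 0 < K & \forall n \near \oo,
  prob (language X n) alpha
    [set omega | (entropy R (sub_SFT X omega) <= (th - eps)%:E)%E] <=
  K * expR (- (th / 2) * n%:R).
Proof.
have [K K1 hK] := weights_le.
have K0 : 0 < K by rewrite (lt_le_trans ltr01).
have [N wN] := SFT_windowed a X_SFT.
have [l l0 hl] := periodic_growth a (wN N (leqnn N)) X0 X_entropy delta_gt0.
(* The factor [expR (th * l)] pays for rounding [C.+1 * n] down to a multiple of [l]. *)
pose c : R := 4 * (C.+1%:R * K * (K ^+ C.+1 * K ^+ C)) * expR (th * l%:R).
exists c; first by rewrite !mulr_gt0 ?exprn_gt0 ?expR_gt0.
near=> n.
have n0 : (0 < n)%N by near: n; exact: nbhs_infty_gt.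
have nN : (N <= n)%N by near: n; exact: nbhs_infty_ge.
have nl : (l <= n)%N by near: n; exact: nbhs_infty_ge.
have neps : ln 2 + eps / 4 * l%:R <= n%:R by near: n; exact: nbhs_infty_ger.
have a0 := ltW alpha_gt0.
have wX := wN n nN.
have [_ q2 q3 q4] := hK n.
(* Growth is known only along the multiples [j.+1 * l]; [p] is the largest one up to [C.+1 * n]. *)
pose j := (C.+1 * n %/ l).-1.
have jl : (0 < C.+1 * n %/ l)%N by rewrite divn_gt0 // (leq_trans nl) // leq_pmull.
have jE : j.+1 = (C.+1 * n %/ l)%N by rewrite /j prednK.
pose p := (j.+1 * l)%N.
have p0 : (0 < p)%N by rewrite muln_gt0.
have pC : (p <= C.+1 * n)%N by rewrite /p jE leq_divM.
have pl : (C.+1 * n < p + l)%N by rewrite /p jE addnC -mulSn ltn_ceil.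
have np : (n <= p)%N.
  rewrite -(leq_add2r l); apply: leq_trans (ltnW pl).
  apply: (@leq_trans (2 * n)); first by rewrite mul2n -addnn leq_add2l.
  by rewrite leq_mul2r ltnS C_gt0 orbT.
have plR : C.+1%:R * n%:R <= p%:R + l%:R :> R by rewrite -natrM -natrD ler_nat ltnW.
have pCR : p%:R <= C.+1%:R * n%:R :> R by rewrite -natrM ler_nat.
pose tau : R := #|per_words a X p|%:R * alpha ^+ p.
have tauE : expR ((th - delta) * p%:R) <= tau.
  have -> : (th - delta) * p%:R = (h - delta) * p%:R + ln alpha * p%:R by rewrite /th; ring.
  by rewrite expRD -alphaX /tau ler_pM2r ?exprn_gt0 //; exact: hl.
have tau0 : 0 < tau by apply: lt_le_trans tauE; exact: expR_gt0.
have Y0 : (0 < #|per_words a X p|)%N.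
  by move: tau0; rewrite /tau pmulr_lgt0 ?exprn_gt0 // ltr0n.
have n0' : 0 <= n%:R :> R by [].
have l0' : 0 <= l%:R :> R by [].
have dth : delta <= th / 2.
  apply: le_trans C_delta; rewrite -[leLHS]mul1r.
  by apply: ler_wpM2r; [exact: ltW|rewrite -natrM ler1n muln_gt0].
apply: (@le_trans _ _ (prob (language X n) alpha [set omega |
    #|per_words a (sub_SFT X omega) p|%:R <= tau / 2])).
  apply: prob_le => // o oX /= ho; rewrite leNgt; apply/negP => big.
  (* The common prefix, the factor 2, [delta] and the rounding cost at most [eps / 2], which leaves
     a strict margin above [th - eps]. *)
  have : ((th - eps / 2)%:E <= entropy R (sub_SFT X o))%E.
    apply: (@entropy_ge_per_words A a R _ n o p _ p0 np (sub_SFT_windowed wX oX)).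
    apply: le_trans (ltW big); apply: (@le_trans _ _ (expR ((th - delta) * p%:R) / 2)); last first.
      by rewrite ler_pM2r // invr_gt0.
    rewrite expn_cardA -expRD ler_pdivlMr // -[X in _ * X](@lnK R) ?posrE // -expRD ler_expR.
    have h1 : (ln #|A|%:R + 1) * n%:R <= C.+1%:R * (eps / 4) * n%:R by rewrite ler_wpM2r.
    have h2 : delta * p%:R <= eps / 4 * p%:R by rewrite ler_wpM2r.
    have h3 : eps / 4 * (C.+1%:R * n%:R) <= eps / 4 * (p%:R + l%:R).
      by rewrite ler_wpM2l // ltW // divr_gt0.
    lra.
  by move=> /le_trans/(_ ho); rewrite lee_fin lerD2l lerN2 leNgt ltr_pdivrMr // ltr_pMr // ltr1n.
apply: (le_trans (@prob_few_periodic R A a X alpha n a0 alpha_le1 n0 C p wX alpha_gt0 p0 pC Y0)).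
rewrite -/tau ler_pdivrMr //.
apply: (@le_trans _ _ (c * expR (- (th / 2) * n%:R) * expR ((th - delta) * p%:R))); last first.
  by rewrite ler_pM2l // mulr_gt0 ?expR_gt0 // !mulr_gt0 ?exprn_gt0 ?expR_gt0.
apply: (@le_trans _ _ (4 * ((C.+1%:R * (K * expR (delta * n%:R))) *
    ((K * expR (delta * n%:R)) ^+ C.+1 * (K * expR ((th + 2 * delta) * n%:R)) ^+ C)))).
  rewrite ler_wpM2l //; apply: ler_pM => //.
  - by rewrite mulr_ge0 ?exprn_ge0 ?language_weight_ge0 // ler0n.
  - by apply: (le_trans pCR); rewrite ler_wpM2l.
  - apply: ler_pM; rewrite ?exprn_ge0 ?language_weight_ge0 ?ler0n //.
      by rewrite lerXn2r // nnegrE ?ler0n // (le_trans (ler0n _ _) q2).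
    by rewrite lerXn2r // nnegrE ?language_weight_ge0 // mulr_ge0 ?expR_ge0 ?ltW.
have -> : 4 * ((C.+1%:R * (K * expR (delta * n%:R))) *
    ((K * expR (delta * n%:R)) ^+ C.+1 * (K * expR ((th + 2 * delta) * n%:R)) ^+ C)) =
  4 * (C.+1%:R * K * (K ^+ C.+1 * K ^+ C)) *
  expR (delta * n%:R + (C.+1%:R * (delta * n%:R) + C%:R * ((th + 2 * delta) * n%:R))).
  by rewrite !expRD !expRM_natl !exprMn; ring.
have -> : c * expR (- (th / 2) * n%:R) * expR ((th - delta) * p%:R) =
  4 * (C.+1%:R * K * (K ^+ C.+1 * K ^+ C)) *
  expR (th * l%:R - th / 2 * n%:R + (th - delta) * p%:R).
  by rewrite /c mulNr !expRD !mulrA.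
apply: ler_wpM2l; first by rewrite !mulr_ge0 ?exprn_ge0 // ltW.
rewrite ler_expR.
have h1 : 4 * C.+1%:R * delta * n%:R <= th / 2 * n%:R by rewrite ler_wpM2r.
have h2 : (th - delta) * (C.+1%:R * n%:R) <= (th - delta) * (p%:R + l%:R).
  have thd : 0 <= th - delta.
    by rewrite subr_ge0 (le_trans dth) // ler_pdivrMr // ler_peMr ?ltW // ltr1n.
  by rewrite ler_wpM2l.
have h3 : 0 <= delta * l%:R by rewrite mulr_ge0 // ltW.
have h4 : 0 <= delta * n%:R by rewrite mulr_ge0 // ltW.
have CE : C.+1%:R = C%:R + 1 :> R by rewrite natr1.
rewrite !CE in h1 h2 *; lra.
Unshelve. all: by end_near.
Qed.

End Tails.

(** * Union of the two tails *)

Theorem theorem1p3 (R : realType) (A : finType) (X : set (int -> A))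
    (hX : is_SFT X) (lambda : R)
    (h_entropy : entropy R X = (ln lambda)%:E)
    (h_pos : (0 < entropy R X)%E)
    (alpha : R) (h_alpha : lambda^-1 < alpha) (h_alpha1 : alpha <= 1)
    (eps : R) (h_eps : 0 < eps) :
  let p := fun n : nat =>
    random_words_prob X alpha n
      [set omega | (eps%:E <=
         `| entropy R (sub_SFT X omega) - (ln (alpha * lambda))%:E |)%E] in
  p n @[n --> \oo] --> (0 : R) /\
  exists K rho : R, [/\ 0 < K, 0 < rho &
    \forall n \near \oo, p n <= K * expR (- rho * n%:R)].
Proof.
move=> p.
have X0 : X !=set0.
  by apply: contrapT => /(@entropy_empty _ R) e; move: h_pos; rewrite e.
have [x _] := X0; have a := x 0.
have ln_gt0 : 0 < ln lambda by move: h_pos; rewrite h_entropy lte_fin.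
have lambda1 : 1 < lambda.
  rewrite ltNge; apply/negP => /ln_le0; lra.
have lambda0 : 0 < lambda by lra.
have alpha0 : 0 < alpha by apply: lt_trans h_alpha; rewrite invr_gt0.
pose th := ln alpha + ln lambda.
have thE : ln (alpha * lambda) = th by rewrite lnM ?posrE.
have th0 : 0 < th.
  rewrite -thE -ln1 ltr_ln ?posrE // ?mulr_gt0 //.
  by move: h_alpha; rewrite -div1r ltr_pdivrMr.
(* The successor makes [C] positive, so that a period close to [C.+1 * n] is at least [n]. *)
pose C := (Num.bound `|4 * (ln #|A|%:R + 1) / eps|).+1.
have C_eps : ln #|A|%:R + 1 <= C.+1%:R * (eps / 4).
  have : 4 * (ln #|A|%:R + 1) / eps <= C.+1%:R.
    apply: (le_trans (ler_norm _)); apply: (le_trans (ltW (archi_boundP (normr_ge0 _)))).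
    by rewrite ler_nat /C; apply: leqW; exact: leqnSn.
  by rewrite ler_pdivrMr // => ?; lra.
pose delta := Num.min (eps / 4) (th / (8 * C.+1%:R)).
have delta0 : 0 < delta by rewrite lt_min !divr_gt0 // mulr_gt0.
have delta_eps : delta <= eps / 4 by rewrite ge_min lexx.
have C_delta : 4 * C.+1%:R * delta <= th / 2.
  have : delta <= th / (8 * C.+1%:R) by rewrite ge_min lexx orbT.
  by rewrite ler_pdivlMr ?mulr_gt0 // => ?; lra.
have alpha_ge0 := ltW alpha0.
have [K1 K10 large] := @prob_large_entropy R A a X alpha (ln lambda) eps delta C
  X0 h_entropy alpha0 h_alpha1 h_eps delta0 delta_eps th0 C_eps.
have [K2 K20 small] := @prob_small_entropy R A a X alpha (ln lambda) eps delta C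
  hX X0 h_entropy alpha0 h_alpha1 h_eps delta0 delta_eps th0 isT C_eps C_delta.
pose rho := Num.min 1 (th / 2).
have rho0 : 0 < rho by rewrite lt_min ltr01 divr_gt0.
have p_ge0 n : 0 <= p n by apply: prob_ge0.
have p_le : \forall n \near \oo, p n <= (K1 + K2) * expR (- rho * n%:R).
  near=> n.
  have n0 : (0 < n)%N by near: n; exact: nbhs_infty_gt.
  have n0' : 0 <= n%:R :> R by [].
  have r1 : rho <= 1 by rewrite ge_min lexx.
  have r2 : rho <= th / 2 by rewrite ge_min lexx orbT.
  apply: (@le_trans _ _ (_ + _)).
    apply: (@prob_union R _ (language X n) alpha alpha_ge0 h_alpha1 _
      [set omega | ((th + eps)%:E <= entropy R (sub_SFT X omega))%E]
      [set omega | (entropy R (sub_SFT X omega) <= (th - eps)%:E)%E]).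
    move=> o oX /=; rewrite thE.
    (* Infinite values fall in one tail; in particular the empty subshift, of entropy [-oo], belongs
       to the lower one. *)
    case: (entropy R (sub_SFT X o)) => [r| |] /=; rewrite ?leey ?leNye; try by [left|right].
    by rewrite !lee_fin; case: (ler0P (r - th)) => h1 h2; [right|left]; lra.
  rewrite mulrDl; apply: lerD.
    apply: (le_trans (large n n0)); rewrite ler_pM2l // ler_expR.
    by rewrite mulNr lerN2 -[leRHS]mul1r ler_wpM2r.
  apply: (@le_trans _ _ (K2 * expR (- (th / 2) * n%:R))); first by near: n.
  by rewrite ler_pM2l // ler_expR ler_wpM2r // lerN2.
split; last by exists (K1 + K2), rho; split=> //; rewrite addr_gt0.
apply: (squeeze_cvgr (f := fun=> 0) (h := fun n => (K1 + K2) * expR (- rho * n%:R))).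
- near=> n; rewrite p_ge0 /=; near: n; exact: p_le.
- exact: cvg_cst.
- rewrite -[X in _ --> X](mulr0 (K1 + K2)); apply: cvgMr.
  have -> : (fun n : nat => expR (- rho * n%:R)) = (fun n => expR (- rho) ^+ n).
    by apply: funext => n; rewrite expRM_natr.
  apply: cvg_expr; rewrite ger0_norm ?expR_ge0 // -expR0 ltr_expR; lra.
Unshelve. all: by end_near.
Qed.
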